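(* Let $d=2$, let $k\in\mathbb{N}$, and let $h:(0,\infty)\to(0,\infty)$ be a gauge function such that $h(2t)\le 2^d h(t)=4h(t)$ and $$\int_0^1 t^{-1}|\log(t)|\sqrt{t^{1-d}h(t)}\,dt=\int_0^1 t^{-1}|\log(t)|\sqrt{t^{-1}h(t)}\,dt<+\infty.$$ Then there exists a compact set $A\subset\mathbb{R}^2$ with the following properties: (1) For each $n$, $A$ can be covered by $C/h(2^{-n})$ balls of radius $2^{-n}$, where $C>0$ depends only on $d$ (that is, since $d=2$, $C$ is an absolute constant). (2) $0<\mathcal{H}^h(A)<\infty$. (3) If $B\subset A$ is a Borel set with $\mathcal{H}^h(B)>0$, then $B$ is not $\mathcal{P}_k$-tube null. In particular, $A$ is not $\mathcal{P}_k$-tube null.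
   Context: A gauge function is a function $h:(0,\infty)\to(0,\infty)$ that is non-decreasing, continuous and satisfies $\lim_{t\downarrow 0}h(t)=0$. The $h$-dimensional Hausdorff measure is $$\mathcal{H}^h(E)=\lim_{\delta\to 0}\inf\Big\{\sum_{i=1}^\infty h(\mathrm{diam}(E_i)) : E\subset\bigcup_i E_i,\ \mathrm{diam}(E_i)<\delta\Big\}.$$ $\mathcal{P}_k$ is the family of (real) algebraic curves in $\mathbb{R}^2$ of degree at most $k$. For a family of curves $\mathcal{F}$ in $\mathbb{R}^2$, an $\mathcal{F}$-tube $T$ of width $w=w(T)>0$ is the $w$-neighborhood of some $F\in\mathcal{F}$. A set $A\subset\mathbb{R}^2$ is $\mathcal{F}$-tube null if for every $\delta>0$ there is a countable covering $\{T_j\}$ of $A$ by $\mathcal{F}$-tubes with $\sum_j w(T_j)<\delta$. *)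

(* Defs.v *)
From HB Require Import structures.
From mathcomp Require Import all_boot all_order all_algebra.
From mathcomp Require Import all_classical all_reals all_analysis.
(* The notations of [mpoly] clash with those of MathComp-Analysis. *)
From mathcomp Require mpoly.
Import -(notations) mpoly.

Set Implicit Arguments.
Unset Strict Implicit.
Unset Printing Implicit Defensive.

Import Order.TTheory GRing.Theory Num.Theory numFieldNormedType.Exports.

Local Open Scope classical_set_scope.
Local Open Scope ring_scope.

Section Defs.
Variable R : realType.
Implicit Types (h : R -> R) (A B S T : set 'rV[R]_2) (x y : 'rV[R]_2).

(* The library norm on ['rV[R]_2] is the sup norm; its topology, used below for
   compact and Borel sets, is the Euclidean one. *)
Definition edist x y : R := Num.sqrt (\sum_(i < 2) (x 0 i - y 0 i) ^+ 2).

Definition ecball x (r : R) : set 'rV[R]_2 := [set y | edist x y <= r].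

(* Centres may be repeated, so this says that at most [N] balls suffice. *)
Definition covered_by_balls (N : nat) (r : R) A : Prop :=
  exists c : 'I_N -> 'rV[R]_2, A `<=` \bigcup_i ecball (c i) r.

(* Adding 0 gives the empty set diameter 0 instead of -oo. *)
Definition diam A : \bar R :=
  ereal_sup ([set 0%E] `|` [set (edist p.1 p.2)%:E | p in A `*` A]).

(* A function (0, +oo) -> (0, +oo) is represented by a function on [R] whose
   values at nonpositive arguments are ignored. *)
Definition gauge_function h : Prop :=
  [/\ forall t, 0 < t -> 0 < h t,
      forall s t, 0 < s -> s <= t -> h s <= h t,
      forall t, 0 < t -> {for t, continuous h}
    & h t @[t --> 0^'+] --> (0 : R)].

(* The contribution h(diam A) of a covering set, with h(0) = 0, the value of
   the continuous extension of a gauge function. It is only used for sets of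
   finite diameter. *)
Definition gauge_diam h A : R :=
  let r := fine (diam A) in if 0 < r then h r else 0.

Definition hausdorff_premeasure h (delta : R) A : \bar R :=
  ereal_inf [set (\sum_(0 <= i <oo) (gauge_diam h (E i))%:E)%E
            | E in [set E : nat -> set 'rV[R]_2 |
                     A `<=` \bigcup_i E i
                     /\ forall i, (diam (E i) < delta%:E)%E]].

Definition hausdorff_measure h A : \bar R :=
  lim (hausdorff_premeasure h delta A @[delta --> 0^'+]).

Definition borel_set B : Prop := <<s [set U : set 'rV[R]_2 | open U] >> B.

(* [msize p] is 1 plus the total degree of [p]; a curve is the zero set of
   a nonconstant polynomial. *)
Definition algebraic_curves (k : nat) : set (set 'rV[R]_2) :=
  [set S | exists2 p : mpoly 2 R,
     (1 < msize p <= k.+1)%N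
     & S = [set x : 'rV[R]_2 | meval (x 0) p = 0]].

Definition is_tube (F : set (set 'rV[R]_2)) (w : R) T : Prop :=
  0 < w /\ exists2 S, F S & T = [set x | exists2 y, S y & edist x y < w].

(* Countable families, possibly finite, are indexed by a set [J] of naturals. *)
Definition tube_null (F : set (set 'rV[R]_2)) A : Prop :=
  forall delta : R, 0 < delta ->
    exists (J : set nat) (w : nat -> R) (T : nat -> set 'rV[R]_2),
      [/\ forall j, J j -> is_tube F (w j) (T j),
          A `<=` \bigcup_(j in J) T j
        & (\esum_(j in J) (w j)%:E < delta%:E)%E].

End Defs.

(* Main.v *)
Require Import Defs.
From HB Require Import structures.
From mathcomp Require Import all_boot all_order all_algebra.
From mathcomp Require Import finmap.
From mathcomp Require Import all_classical all_reals all_analysis.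
From mathcomp Require Import polyorder polyrcf.
From mathcomp Require Import zify ring lra.
From mathcomp Require mpoly.
Import -(notations) mpoly.
Import measurable_realfun.

(* The set is the limit of a tree of dyadic squares in which every square of a
   given level has either all four children or a single one, the numbers of
   squares being matched to 1/h. For a curve F and a square Q let nu_F(Q) be the
   length of the coordinate projections of F in Q, counted with multiplicity;
   nu_F(Q) is at most a constant times the side of Q. Choosing the single child
   at random keeps the density-weighted sum of nu_F over the surviving squares
   constant on average, and a Chernoff bound makes its relative fluctuation at
   level m at most of order sqrt(m 2^m / N_m), N_m being the number of squares,
   which is summable by the integral condition. The union bound over all F needs
   only exp(O(m)) cases: with multiplicities counted by the Budan-Fourier
   numbers of sign variations, nu_F is determined up to a negligible error by
   the signs of partial derivatives at exp(O(m)) grid points, which are linear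
   forms in the coefficients, and M linear forms in dimension D have at most
   (3M + 1)^D sign patterns. The random choice is replaced by a greedy one
   driven by the exponential moments.

   Consequently at most a constant times 2^-m N_m squares of level m come near
   a given curve. A set covered by tubes of small total width is then covered
   by squares of small total gauge, so its Hausdorff measure is 0. *)

Set Implicit Arguments.
Unset Strict Implicit.
Unset Printing Implicit Defensive.

Import Order.TTheory GRing.Theory Num.Theory numFieldNormedType.Exports.

Local Open Scope classical_set_scope.
Local Open Scope ring_scope.
(* MathComp-Analysis has an [edist] of its own. *)
Local Notation edist := Defs.edist.

(** * Sign variations of the derivatives *)

Section BudanFourier.
Variable R : rcfType.
Implicit Types (p f : {poly R}) (a b : R) (k : nat).

(** The first nonzero derivative at [a] decides the sign of [f] on a right neighbourhood of [a];
    order [k] suffices when [size f <= k.+1]. *)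
Fixpoint rsgn k f a : R :=
  if k is k'.+1 then
    if f.[a] == 0 then rsgn k' f^`() a else Num.sg f.[a]
  else Num.sg f.[a].

(* The number of sign variations of f, f', ..., f^(k) just to the right of a. *)
Fixpoint svar k f a : nat :=
  if k is k'.+1 then
    ((rsgn k f a * rsgn k' f^`() a < 0)%R + svar k' f^`() a)%N
  else 0%N.

Lemma svarS k f a : svar k.+1 f a =
  ((rsgn k.+1 f a * rsgn k f^`() a < 0)%R + svar k f^`() a)%N.
Proof. by []. Qed.

Lemma right_gap p a b : p != 0 -> a < b ->
  exists2 c, a < c <= b & forall x, a < x <= c -> ~~ root p x.
Proof.
move=> p0 ab; have gt := next_root_gt ab p0; have := next_root_in p a b.
rewrite in_itv /= (max_l (ltW ab)) => /andP[_ le].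
exists ((a + next_root p a b) / 2); first by apply/andP; split; lra.
move=> x /andP[ax xc]; apply: (@next_noroot _ p a b).
by rewrite in_itv /= ax /=; lra.
Qed.

Lemma left_gap p a b : p != 0 -> a < b ->
  exists2 c, a <= c < b & forall x, c <= x < b -> ~~ root p x.
Proof.
move=> p0 ab; have lt := prev_root_lt ab p0; have := prev_root_in p a b.
rewrite in_itv /= (min_l (ltW ab)) => /andP[le _].
exists ((prev_root p a b + b) / 2); first by apply/andP; split; lra.
move=> x /andP[cx xb]; apply: (@prev_noroot _ p a b).
by rewrite in_itv /= xb andbT; lra.
Qed.

Lemma noroot_sg p a b : a <= b -> (forall x, a <= x <= b -> ~~ root p x) ->
  Num.sg p.[a] = Num.sg p.[b].
Proof.
move=> ab H; apply: (@polyrN0_itv _ `[a, b]).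
- by move=> x; rewrite in_itv /= => /H.
- by rewrite in_itv /= lexx ab.
- by rewrite in_itv /= lexx ab.
Qed.

Lemma mean_value_sg p a b : a < b ->
  exists2 c, a < c < b & Num.sg p^`().[c] = Num.sg (p.[b] - p.[a]).
Proof.
move=> ab; have [c] := poly_mvt p ab; rewrite in_itv /= => cab ->.
by exists c => //; rewrite sgrM (gtr0_sg (_ : 0 < b - a)) ?mulr1 ?subr_gt0.
Qed.

Lemma deriv0_const p a b : p^`() = 0 -> p.[a] = p.[b].
Proof.
move=> p'0; wlog ab : a b / a < b.
  by move=> H; case: (ltgtP a b) => [/H//|/H//|->].
have [c _] := mean_value_sg p ab.
by rewrite p'0 horner0 sgr0 => /esym/eqP; rewrite sgr_eq0 subr_eq0 => /eqP.
Qed.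

Lemma size_deriv_le k f : (size f <= k.+2)%N -> (size f^`() <= k.+1)%N.
Proof. by rewrite size_deriv; case: size. Qed.

(** If [p] vanishes at [a], the mean value theorem gives its derivative the sign [t] somewhere to
    the right of [a], hence on a whole interval free of its roots, and induction applies to the
    derivative. *)
Lemma rsgn_right k p a b t : t != 0 -> a < b -> (size p <= k.+1)%N ->
  (forall x, a < x <= b -> Num.sg p.[x] = t) -> rsgn k p a = t.
Proof.
move=> t0; elim: k p b => [|k IH] p b ab sp H /=.
  rewrite -(H b) ?ab ?lexx //.
  by rewrite (size1_polyC sp) !hornerC.
have Hr x : a < x <= b -> ~~ root p x.
  by move=> /H px; rewrite /root -sgr_eq0 px.
case: eqP => [pa0|/eqP pa0]; last first.
  rewrite (@noroot_sg p a b) ?ltW // ?H ?ab ?lexx// => x /andP[ax xb].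
  by have [<-//|ne] := eqVneq a x; apply: Hr; rewrite xb lt_neqAle ne ax.
have p'0 : p^`() != 0.
  apply: contra t0 => /eqP/(@deriv0_const p a b) e.
  by rewrite -(H b) ?ab ?lexx// -e pa0 sgr0.
have [c /andP[ac cb] nr] := right_gap p'0 ab.
apply: (IH _ c) => //.
  exact: size_deriv_le.
move=> x /andP[ax xc].
have [d /andP[ad dc]] := mean_value_sg p ac.
rewrite pa0 subr0 (H c) ?ac ?cb// => <-.
wlog xd : x d ax xc ad dc / x <= d.
  move=> W; case/orP: (le_total x d) => [xd|dx]; first exact: W.
  case: (ltgtP d x) dx => // [dx _|->//]; apply/esym.
  apply: noroot_sg; first exact: ltW.
  by move=> y /andP[dyad yx]; apply: nr; rewrite (lt_le_trans ad dyad) (le_trans yx).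
by apply: noroot_sg => // y /andP[xy yd]; apply: nr;
  rewrite (lt_le_trans ax xy) (le_trans yd (ltW dc)).
Qed.

Lemma rsgn_self k f a : f.[a] != 0 -> rsgn k f a = Num.sg f.[a].
Proof. by case: k => //= k /negPf->. Qed.

Lemma rsgn0 k a : rsgn k 0 a = 0.
Proof. by elim: k => [|k IH] /=; rewrite ?horner0 ?sgr0 ?eqxx ?deriv0. Qed.

(* If f and f' agree in sign to the right of a but not to the right of b, then
   f' has a root in ]a, b], and the strict decrease for f' pays for the new
   variation; this is why both claims are proved together. *)
Lemma svar_le_lt k f a b : (size f <= k.+1)%N -> a <= b ->
  (svar k f b <= svar k f a)%N /\
  (forall c, f != 0 -> a < c <= b -> root f c -> (svar k f b < svar k f a)%N).
Proof.
elim: k f a b => [|k IH] f a b sf ab.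
  split=> // c f0 _ /rootP fc; exfalso; move/negP: f0; apply; apply/eqP.
  by move: fc; rewrite (size1_polyC sf) hornerC => ->.
have sf' := size_deriv_le sf.
have mono u v : u <= v -> (svar k.+1 f v <= svar k.+1 f u)%N.
  move=> uv; rewrite !svarS.
  have [Hle Hlt] := IH _ u v sf' uv.
  set iv := (_ < 0); set iu := (_ < 0).
  have [iviu|] := boolP (iv ==> iu).
    by apply: leq_add => //; move: iviu; case: iv; case: iu.
  rewrite negb_imply => /andP[Hiv Hiu].
  suff H : (svar k f^`() v < svar k f^`() u)%N by rewrite Hiv (negPf Hiu).
  have [f'0|f'0] := eqVneq f^`() 0.
    by move: Hiv; rewrite /iv f'0 rsgn0 mulr0 ltxx.
  have uv' : u < v.
    rewrite lt_neqAle uv andbT; apply: contraTN Hiv => /eqP e.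
    by move: Hiu; rewrite /iu /iv e.
  (* Otherwise the derivative keeps one sign on ]u, v], opposite to that of f(v); then f(u) has the
     sign of f(v) too, and the variation was already present at [u]. *)
  apply: contrapT => Hn.
  have nr c : u < c <= v -> ~~ root f^`() c.
    by move=> ucv; apply/negP => rc; apply: Hn; apply: (Hlt c).
  have f'v : f^`().[v] != 0 by apply: nr; rewrite uv' lexx.
  have fv : f.[v] != 0.
    apply: contraTN Hiv => /eqP fv; rewrite /iv /= fv eqxx -leNgt.
    exact: sqr_ge0.
  have sgc x : u < x <= v -> Num.sg f^`().[x] = Num.sg f^`().[v].
    move=> /andP[ux xv]; apply: noroot_sg => // y /andP[xy yv].
    by apply: nr; rewrite yv (lt_le_trans ux).
  have sgu : rsgn k f^`() u = Num.sg f^`().[v].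
    by apply: (rsgn_right _ uv') => //; rewrite sgr_eq0.
  move: Hiv Hiu; rewrite /iv /iu sgu (rsgn_self k f'v) (rsgn_self k.+1 fv).
  have [c /andP[uc cv]] := mean_value_sg f uv'.
  rewrite sgc ?uc ?ltW// => ->.
  case: (sgrP (f.[v] - f.[u])) => H; rewrite ?mulr0 ?ltxx// ?mulr1 ?mulrN1 ?oppr_lt0.
    rewrite sgr_lt0 => fv0.
    have fu0 : f.[u] < 0 by lra.
    by rewrite rsgn_self ?lt_eqF// sgr_lt0 fu0.
  rewrite sgr_gt0 => fv0.
  have fu0 : 0 < f.[u] by lra.
  by rewrite rsgn_self ?gt_eqF// sgr_gt0 fu0.
split; first exact: mono.
move=> c f0 /andP[ac cb] fc.
have f'0 : f^`() != 0.
  apply: contra f0 => /eqP f'0.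
  apply/eqP; rewrite (size1_polyC (_ : (size f <= 1)%N)).
    by move: fc => /rootP; rewrite (deriv0_const c 0 f'0) horner_coef0 => ->.
  by move: f'0 => /eqP; rewrite -size_poly_eq0 size_deriv; case: size => [|[]].
(* Just left of its root [c], [f] has the sign opposite to its derivative. This variation, present
   at [d], is lost at [c], where [rsgn] of [f] equals that of the derivative. *)
have [d /andP[ad dc] nr] := left_gap (mulf_neq0 f0 f'0) ac.
have nrf x : d <= x < c -> f.[x] != 0 /\ f^`().[x] != 0.
  by move=> /nr; rewrite rootM negb_or => /andP[].
apply: leq_ltn_trans (mono _ _ cb) _; apply: leq_trans (mono _ _ ad).
have [fd f'd] : f.[d] != 0 /\ f^`().[d] != 0 by apply: nrf; rewrite lexx.
have E : rsgn k.+1 f c = rsgn k f^`() c by rewrite /= (rootP fc) eqxx.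
rewrite !svarS E (rsgn_self _ fd) (rsgn_self _ f'd).
rewrite ltNge -expr2 sqr_ge0 add0n.
suff -> : Num.sg f.[d] * Num.sg f^`().[d] < 0.
  by rewrite add1n ltnS; have [] := IH _ d c sf' (ltW dc).
have [x /andP[dx xc]] := mean_value_sg f dc.
rewrite (rootP fc) sub0r sgrN.
rewrite -(@noroot_sg _ d x) ?(ltW dx)// => [->|y /andP[dyad yx]].
  by rewrite mulrN oppr_lt0 -expr2 sqr_sg fd ltr01.
by apply: (nrf y _).2; rewrite dyad (le_lt_trans yx).
Qed.

Lemma svar_le k f a b : (size f <= k.+1)%N -> a <= b ->
  (svar k f b <= svar k f a)%N.
Proof. by move=> sf ab; have [] := svar_le_lt sf ab. Qed.

Lemma svar_lt k f a b c : (size f <= k.+1)%N -> f != 0 -> a < c <= b ->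
  root f c -> (svar k f b < svar k f a)%N.
Proof.
move=> sf f0 acb fc; have ab : a <= b.
  by case/andP: acb => /ltW ac; exact: le_trans.
by have [_ H] := svar_le_lt sf ab; apply: H f0 acb fc.
Qed.

Lemma svar_max k f a : (svar k f a <= k)%N.
Proof. by elim: k f => [//|k IH] f; rewrite svarS -[k.+1]add1n leq_add ?leq_b1. Qed.

Lemma rsgn_ext k f g a b :
  (forall l, (l <= k)%N -> Num.sg f^`(l).[a] = Num.sg g^`(l).[b]) ->
  rsgn k f a = rsgn k g b.
Proof.
elim: k f g => [|k IH] f g H /=; first exact: (H 0%N).
have H0 := H 0%N isT; rewrite !derivn0 in H0.
rewrite -!(sgr_eq0 _.[_]) H0; case: ifP => // _.
by apply: IH => l lk; rewrite -!derivSn; apply: H.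
Qed.

Lemma svar_ext k f g a b :
  (forall l, (l <= k)%N -> Num.sg f^`(l).[a] = Num.sg g^`(l).[b]) ->
  svar k f a = svar k g b.
Proof.
elim: k f g => //= k IH f g H.
have H' l : (l <= k)%N -> Num.sg (f^`())^`(l).[a] = Num.sg (g^`())^`(l).[b].
  by move=> lk; rewrite -!derivSn; apply: H.
have H0 := H 0%N isT; rewrite !derivn0 in H0.
by rewrite -!(sgr_eq0 _.[_]) H0 (IH _ _ H') (rsgn_ext H').
Qed.

End BudanFourier.

(** * Sign patterns of linear forms *)

Section SignPatterns.
Variables (R : realFieldType) (V : vectType R).
Implicit Types (U : {vspace V}) (Ls : seq 'Hom(V, R^o)) (v w : V).

Definition same_signs Ls v w :=
  forall l : 'Hom(V, R^o), l \in Ls -> Num.sg (l v : R) = Num.sg (l w : R).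

Lemma sg_pos_comb (a b s t : R) : 0 < s -> 0 < t -> Num.sg a = Num.sg b ->
  Num.sg (s * a + t * b) = Num.sg a.
Proof.
move=> s0 t0; case: (sgrP b) => [->|b0|b0].
- by move=> /eqP; rewrite sgr_eq0 => /eqP ->; rewrite !mulr0 addr0.
- by move=> /eqP; rewrite sgr_cp0 => a0; rewrite !gtr0_sg// addr_gt0 ?mulr_gt0.
- move=> /eqP; rewrite sgr_cp0 => a0; rewrite !ltr0_sg//.
  by rewrite -oppr_gt0 opprD -!mulrN addr_gt0 ?mulr_gt0 ?oppr_gt0.
Qed.

(* If l takes different signs on a class of vectors with the same signs on Ls,
   then the class meets the kernel of l. *)
Lemma same_signs_ker Ls U (l : 'Hom(V, R^o)) v w :
  v \in U -> w \in U -> same_signs Ls v w -> Num.sg (l v : R) != Num.sg (l w : R) ->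
  exists2 u, u \in (U :&: lker l)%VS & same_signs Ls u v.
Proof.
wlog lvw : v w / (l v : R) <= (l w : R).
  move=> W vU wU vw ne; case/orP: (le_total (l v : R) (l w : R)) => H.
    exact: (W v w).
  have wv : same_signs Ls w v by move=> m /vw.
  rewrite eq_sym in ne; have [u uU uw] := W w v H wU vU wv ne.
  by exists u => // m mL; rewrite vw// uw.
move=> vU wU vw ne.
have [lv0|lv0] := eqVneq (l v : R) 0.
  by exists v => //; rewrite memv_cap vU memv_ker lv0 eqxx.
have [lw0|lw0] := eqVneq (l w : R) 0.
  exists w; first by rewrite memv_cap wU memv_ker lw0 eqxx.
  by move=> m /vw.
have [lvN lwP] : (l v : R) < 0 /\ 0 < (l w : R).
  move: ne lvw lv0 lw0.
  by case: (sgrP (l v : R)); case: (sgrP (l w : R)) => //; rewrite ?eqxx //; lra.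
exists ((l w : R) *: v + (- (l v : R)) *: w).
  rewrite memv_cap rpredD ?rpredZ// memv_ker linearD !linearZ /=.
  by apply/eqP; rewrite /GRing.scale /=; ring.
move=> m mL; rewrite linearD !linearZ /=.
by apply: sg_pos_comb; rewrite ?oppr_gt0// vw.
Qed.

Let leq_exp2r' m n e : (m <= n)%N -> (m ^ e <= n ^ e)%N.
Proof. by case: e => // e mn; rewrite leq_exp2r. Qed.

(** Induction on the forms. A class of [Ls] split by [l] meets the kernel of [l], so it is
    represented in a space of dimension one less, with three signs of [l] to choose from; the count
    closes because a^d + 3 a^(d-1) <= (a + 3)^d. *)
Lemma sign_reps Ls U :
  exists2 L : seq V, (size L <= (3 * size Ls + 1) ^ \dim U)%N &
    forall v, v \in U -> exists2 w, w \in L & w \in U /\ same_signs Ls w v.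
Proof.
elim: Ls U => [|l Ls IH] U.
  exists [:: 0] => [|v vU]; first by rewrite exp1n.
  by exists 0; rewrite ?mem_head// mem0v.
have [L sL HL] := IH U.
set U0 := (U :&: lker l)%VS.
have dimU : (\dim U0 + \dim (l @: U) = \dim U)%N by exact: limg_ker_dim.
have [d0|d0] := posnP (\dim (l @: U)).
  exists L; first by apply: leq_trans sL _; apply: leq_exp2r' => /=; lia.
  move=> v vU; have [w wL [wU ws]] := HL v vU.
  exists w => //; split=> // m; rewrite inE => /orP[/eqP->|/ws//].
  have l0 x : x \in U -> l x = 0.
    move=> xU; apply/eqP; rewrite -memv0.
    by rewrite -(_ : l @: U = 0)%VS ?memv_img//; apply/eqP; rewrite -dimv_eq0 d0.
  by rewrite !l0.
have [L0 sL0 HL0] := IH U0.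
(* A vector of [U] in the class of [v] on which [l] has sign [s]; the default 0 is taken only when
   there is none. *)
pose pick s v : V := xget 0 [set w | [/\ w \in U, same_signs Ls w v & Num.sg (l w : R) = s]].
exists (L ++ [seq pick s v | s <- [:: 0; 1; -1], v <- L0]).
  rewrite size_cat size_allpairs /=.
  have e : (\dim U = (\dim U).-1.+1)%N by rewrite prednK//; lia.
  have d0U : (\dim U0 <= (\dim U).-1)%N by lia.
  rewrite e in sL *; set a := (3 * size Ls + 1)%N in sL sL0 *.
  set b := (3 * (size Ls).+1 + 1)%N; have -> : b = (a + 3)%N by rewrite /a /b; lia.
  rewrite !expnS mulnDl leq_add//.
    by rewrite (leq_trans sL)// expnS leq_mul2l leq_exp2r' ?leq_addr ?orbT.
  rewrite leq_mul2l /= (leq_trans sL0)// (@leq_trans (a ^ (\dim U).-1))//.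
    by rewrite leq_pexp2l// /a addn1.
  by rewrite leq_exp2r' ?leq_addr.
move=> v vU; have [w wL [wU ws]] := HL v vU.
have [lwv|lwv] := eqVneq (Num.sg (l w : R)) (Num.sg (l v : R)).
  exists w; first by rewrite mem_cat wL.
  by split=> // m; rewrite inE => /orP[/eqP->|/ws].
have [u uU0 uw] := same_signs_ker wU vU ws lwv.
have [u' u'L0 [u'U0 u'u]] := HL0 u uU0.
set s := Num.sg (l v : R).
exists (pick s u').
  rewrite mem_cat; apply/orP; right; apply: allpairs_f => //.
  by rewrite /s; case: sgrP; rewrite !inE eqxx ?orbT.
rewrite /pick; case: xgetP => [x _ [xU xs xl]|/(_ v)].
  split=> // m; rewrite inE => /orP[/eqP->|mL]; first by rewrite xl.
  by rewrite xs// u'u// uw// ws.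
case; split=> // m mL.
by rewrite u'u// uw// ws.
Qed.
End SignPatterns.

(** * Bivariate polynomials *)

Section BivariatePolynomials.
Variables (R : rcfType) (k : nat).
Implicit Types (c : 'M[R]_k.+1) (x y a : R) (l : nat).

(* [c] encodes the polynomial sum_(i, j <= k) c_ij x^i y^j. *)
Definition cpoly c x : {poly R} := rVpoly ((\row_(i < k.+1) x ^+ i) *m c).

Lemma size_cpoly c x : (size (cpoly c x) <= k.+1)%N.
Proof. exact: size_poly. Qed.

Lemma horner_cpoly c x y :
  (cpoly c x).[y] = \sum_(i < k.+1) \sum_(j < k.+1) c i j * x ^+ i * y ^+ j.
Proof.
rewrite (horner_coef_wide _ (size_cpoly c x)) exchange_big /=.
apply: eq_bigr => j _; rewrite coef_rVpoly_ord mxE mulr_suml.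
by apply: eq_bigr => i _; rewrite mxE; ring.
Qed.

Lemma cpoly_tr c x y : (cpoly c^T y).[x] = (cpoly c x).[y].
Proof.
rewrite !horner_cpoly exchange_big; apply: eq_bigr => i _.
by apply: eq_bigr => j _; rewrite mxE; ring.
Qed.

(** Operators in the variable y become right multiplications of the coefficient matrix, so
    derivatives and translates stay in one finite-dimensional space. *)
Lemma rV_linear_op (F : {linear {poly R} -> {poly R}}) c x :
  (forall p : {poly R}, (size p <= k.+1)%N -> (size (F p) <= k.+1)%N) ->
  cpoly (c *m lin1_mx (poly_rV \o F \o rVpoly)) x = F (cpoly c x).
Proof.
move=> sF; rewrite /cpoly mulmxA mul_rV_lin1 /= poly_rV_K//.
by apply: sF; exact: size_poly.
Qed.

Definition dmx c : 'M[R]_k.+1 := c *m lin1_mx (poly_rV \o (@deriv R) \o rVpoly).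

Lemma cpoly_dmx c x l : cpoly (iter l dmx c) x = (cpoly c x)^`(l).
Proof.
elim: l => [|l IH]; first by rewrite derivn0.
rewrite derivnS -IH; apply: rV_linear_op => p sp.
have [->|p0] := eqVneq p 0; first by rewrite linear0 size_poly0.
exact/(leq_trans (ltnW (lt_size_deriv p0))).
Qed.

Definition tmx a c : 'M[R]_k.+1 := c *m lin1_mx (poly_rV \o (comp_poly ('X + a%:P)) \o rVpoly).

Lemma cpoly_tmx a c x y : (cpoly (tmx a c) x).[y] = (cpoly c x).[y + a].
Proof.
rewrite rV_linear_op ?horner_comp ?hornerE// => p sp.
by rewrite size_comp_poly2// size_XaddC.
Qed.

Lemma cpoly_inj0 c : (forall x y, (cpoly c x).[y] = 0) -> c = 0.
Proof.
move=> H.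
have inf (p : {poly R}) : (forall y, p.[y] = 0) -> p = 0.
  move=> p0; apply/eqP; apply: contraT => pn0.
  have := @max_poly_roots _ p [seq n%:R | n <- iota 0 (size p)] pn0.
  rewrite size_map size_iota ltnn; apply.
    by apply/allP => z _; apply/rootP.
  rewrite map_inj_uniq ?iota_uniq//.
  by move=> u v /eqP; rewrite eqr_nat => /eqP.
apply/matrixP => i j; rewrite mxE.
suff /(congr1 (fun p : {poly R} => p`_i)) : rVpoly (col j c)^T = 0.
  by rewrite coef_rVpoly_ord coef0 !mxE.
apply: (inf _) => x.
have := congr1 (fun p : {poly R} => p`_j) (inf (cpoly c x) (H x)).
rewrite coef0 coef_rVpoly_ord mxE => <-.
rewrite (horner_coef_wide _ (size_poly _ _)).
by apply: eq_bigr => l _; rewrite coef_rVpoly_ord !mxE mulrC.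
Qed.

Lemma tmx_eq0 a c : tmx a c = 0 -> c = 0.
Proof.
move=> t0; apply: cpoly_inj0 => x y.
rewrite -(subrK a y) -cpoly_tmx t0 /cpoly mulmx0 linear0.
by rewrite horner0.
Qed.

Definition svarc c x y := svar k (cpoly c x) y.

Lemma svarc_le c x y y' : y <= y' -> (svarc c x y' <= svarc c x y)%N.
Proof. by apply: svar_le; exact: size_cpoly. Qed.

Lemma svarc_lt c x y y' z : cpoly c x != 0 -> y < z <= y' ->
  (cpoly c x).[z] = 0 -> (svarc c x y' < svarc c x y)%N.
Proof. by move=> c0 yz /eqP; apply: svar_lt => //; exact: size_cpoly. Qed.

Lemma sg_change_root (p : {poly R}) x x' : x <= x' ->
  Num.sg p.[x] != Num.sg p.[x'] ->
  p != 0 /\ exists2 z, x <= z <= x' & root p z.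
Proof.
move=> xx' ne; split.
  by apply: contra ne => /eqP ->; rewrite !horner0.
apply: contrapT => H; move/negP: ne; apply; apply/eqP/noroot_sg => // z zx.
by apply/negP => rz; apply: H; exists z.
Qed.

(** [svarc] depends only on the signs of the derivatives in y, so a change along a row forces one of
    them, read through the transpose as a polynomial in x, to vanish in between. *)
Lemma svarc_change c x x' y : x <= x' -> svarc c x y <> svarc c x' y ->
  exists2 l, (l <= k)%N & cpoly (iter l dmx c)^T y != 0 /\
    exists2 z, x <= z <= x' & root (cpoly (iter l dmx c)^T y) z.
Proof.
move=> xx' ne; apply: contrapT => H; apply: ne; apply: svar_ext => l lk.
rewrite -!cpoly_dmx -(cpoly_tr _ x y) -(cpoly_tr _ x' y); apply/eqP;
  apply: contrapT => /negP /(sg_change_root xx') ?.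
by apply: H; exists l.
Qed.

(** The coefficient matrix is the variable here: the samples are linear forms in it, as [sign_reps]
    requires. *)
Definition sample_form x y l : 'Hom('M[R]_k.+1, R^o) :=
  linfun (fun c => (cpoly c x)^`(l).[y] : R^o).

Lemma sample_formE x y l c : sample_form x y l c = (cpoly c x)^`(l).[y].
Proof.
have lin : linear (fun c => (cpoly c x)^`(l).[y] : R^o).
  move=> b u v; rewrite /cpoly mulmxDr -scalemxAr linearP /=.
  by rewrite linearP /= hornerD hornerZ.
pose f := GRing.isLinear.Build R _ _ _ (fun c => (cpoly c x)^`(l).[y] : R^o) lin.
pose F : {linear _ -> _} := HB.pack (fun c => (cpoly c x)^`(l).[y] : R^o) f.
exact: (lfunE F c).
Qed.

Lemma svarc_ext c c' x y :
  (forall l, (l <= k)%N -> Num.sg (sample_form x y l c : R) =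
                           Num.sg (sample_form x y l c' : R)) ->
  svarc c x y = svarc c' x y.
Proof. by move=> H; apply: svar_ext => l /H; rewrite !sample_formE. Qed.

End BivariatePolynomials.

(** * Sampled counts on dyadic cells *)

Section Counting.
Variables (R : rcfType) (k : nat).
Implicit Types (c : 'M[R]_k.+1) (x y : R) (r m u i j : nat).

Definition dyad u r : R := u%:R / 2 ^+ r.

Lemma exp2_gt0 r : 0 < 2 ^+ r :> R. Proof. by rewrite exprn_gt0. Qed.

Lemma dyad_le u v r : (dyad u r <= dyad v r) = (u <= v)%N.
Proof. by rewrite /dyad ler_pM2r ?invr_gt0 ?exp2_gt0// ler_nat. Qed.

Lemma dyad_lt u v r : (dyad u r < dyad v r) = (u < v)%N.
Proof. by rewrite /dyad ltr_pM2r ?invr_gt0 ?exp2_gt0// ltr_nat. Qed.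

Lemma dyad_mul u r s : dyad (2 ^ s * u) (s + r) = dyad u r.
Proof.
by rewrite /dyad natrM natrX exprD -mulf_div divff ?mul1r// gt_eqF ?exp2_gt0.
Qed.

(** Budan-Fourier substitute for the number of roots on column [x] in a half-open dyadic interval:
    still additive under bisection and at most [k], but determined by signs at the two end
    points. *)
Definition drop_at c x m j := (svarc c x (dyad j m) - svarc c x (dyad j.+1 m))%N.

(* 2^-r cnt is a Riemann sum for the length of the projection to the x-axis of
   the part of the curve in the cell (i, j), with Budan-Fourier multiplicities. *)
Definition cnt r m c i j :=
  (\sum_(i * 2 ^ (r - m) <= u < i.+1 * 2 ^ (r - m)) drop_at c (dyad u r) m j)%N.

Lemma drop_at_le c x m j : (drop_at c x m j <= k)%N.
Proof. exact/(leq_trans (leq_subr _ _))/svar_max. Qed.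

Lemma drop_at_split c x m j :
  drop_at c x m j = (drop_at c x m.+1 (2 * j) + drop_at c x m.+1 (2 * j).+1)%N.
Proof.
rewrite /drop_at.
have -> : dyad (2 * j) m.+1 = dyad j m by rewrite -(dyad_mul j m 1).
have -> : dyad (2 * j).+2 m.+1 = dyad j.+1 m by rewrite -(dyad_mul j.+1 m 1); congr dyad; lia.
have jm : dyad j m <= dyad (2 * j).+1 m.+1.
  by rewrite -(dyad_mul j m 1) dyad_le expn1.
have mj : dyad (2 * j).+1 m.+1 <= dyad j.+1 m.
  by rewrite -(dyad_mul j.+1 m 1) dyad_le expn1 mulnS; lia.
have := svarc_le c x jm; have := svarc_le c x mj.
by move=> H1 H2; lia.
Qed.

Lemma cnt_le r m c i j : (cnt r m c i j <= 2 ^ (r - m) * k)%N.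
Proof.
rewrite /cnt; apply: (@leq_trans (\sum_(i * 2 ^ (r - m) <= u < i.+1 * 2 ^ (r - m)) k)%N).
  by apply: leq_sum => u _; exact: drop_at_le.
by rewrite sum_nat_const_nat mulSn addnK mulnC mulnC.
Qed.

Lemma cnt_split r m c i j : (m < r)%N -> cnt r m c i j =
  (cnt r m.+1 c (2 * i) (2 * j) + cnt r m.+1 c (2 * i) (2 * j).+1 +
   (cnt r m.+1 c (2 * i).+1 (2 * j) + cnt r m.+1 c (2 * i).+1 (2 * j).+1))%N.
Proof.
move=> mr; rewrite /cnt -!big_split /=.
have e : (2 ^ (r - m) = 2 * 2 ^ (r - m.+1))%N by rewrite -expnS; congr expn; lia.
under [in RHS]eq_bigr do rewrite -drop_at_split.
under [X in (_ + X)%N]eq_bigr do rewrite -drop_at_split.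
rewrite e mulnA (mulnC i) mulnA (mulnC i.+1) mulnS add2n -big_cat_nat//= ?leq_mul2r ?leqnSn ?orbT//.
Qed.

Lemma sum_blocks (F : nat -> nat) s a b : (a <= b)%N ->
  (\sum_(a * s <= u < b * s) F u = \sum_(a <= u < b) \sum_(e < s) F (u * s + e))%N.
Proof.
move=> ab; rewrite -(subnK ab); elim: (b - a)%N => [|n IH].
  by rewrite add0n !big_geq.
rewrite addSn big_nat_recr ?leq_addl//= -IH.
rewrite (@big_cat_nat _ _ _ ((n + a) * s))/= ?leq_mul2r ?leq_addl ?leqnSn ?orbT//.
congr addn; rewrite mulSn; move: (_ * s)%N => x.
rewrite -{1}[x]add0n big_addn addnK big_mkord.
by apply: eq_bigr => e _; rewrite addnC.
Qed.

Definition root_in (p : {poly R}) r u : bool :=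
  `[< p != 0 /\ exists2 z, dyad u r <= z < dyad u.+1 r & root p z >].

(** One root chosen in each block gives distinct roots, since the half-open blocks are disjoint. *)
Lemma root_blocks (p : {poly R}) r a b : (size p <= k.+1)%N ->
  (\sum_(a <= u < b) root_in p r u <= k)%N.
Proof.
move=> sp; rewrite -big_mkcond/= sum1_count -size_filter.
set s := [seq u <- _ | _].
have [->//|s_gt0] := posnP (size s).
have rs u : u \in s -> root_in p r u by rewrite mem_filter => /andP[].
have p0 : p != 0.
  by have /asboolP[] := rs _ (mem_nth 0%N s_gt0).
pose g u : R := xget 0 [set z | dyad u r <= z < dyad u.+1 r /\ root p z].
have gP u : u \in s -> dyad u r <= g u < dyad u.+1 r /\ root p (g u).
  move=> /rs/asboolP[_ [z uz rz]].
  rewrite /g; case: xgetP => [_ _ []//|/(_ z)]; case; split=> //.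
rewrite -ltnS -(size_map g); apply: leq_trans sp; apply: max_poly_roots => //.
  by apply/allP => _ /mapP[u us ->]; have [] := gP u us.
rewrite map_inj_in_uniq ?filter_uniq ?iota_uniq// => u v us vs guv.
have [/andP[u1 u2] _] := gP u us; have [/andP[v1 v2] _] := gP v vs.
rewrite guv in u1 u2.
have A : (u < v.+1)%N by rewrite -(dyad_lt _ _ r) (le_lt_trans u1 v2).
have B : (v < u.+1)%N by rewrite -(dyad_lt _ _ r) (le_lt_trans v1 u2).
by apply/eqP; rewrite eqn_leq -ltnS A -ltnS B.
Qed.

(* Refining the sampling changes the count only on the few blocks that contain
   a root of one of the polynomials whose signs determine it. *)
Lemma cnt_refine r m c i j : (m <= r)%N ->
  (cnt (r + 3) m c i j <= 8 * cnt r m c i j + 16 * k ^ 2 * k.+1)%N.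
Proof.
move=> mr; rewrite /cnt.
have -> : (2 ^ (r + 3 - m) = 2 ^ (r - m) * 8)%N by rewrite -(expnD 2 _ 3); congr expn; lia.
rewrite !mulnA sum_blocks ?leq_mul2r ?leqnSn ?orbT//.
set a := (i * _)%N; set b := (_ * _)%N.
pose g y l := cpoly (iter l (@dmx R k) c)^T y.
(* [bad] counts the derivatives on the bottom and top rows of the cell having a root in block [u].
   Its sum over the blocks is at most 2k(k + 1), and a bad block costs at most 8k, whence 16 k^2 (k
   + 1). *)
pose bad u := (\sum_(l < k.+1) (root_in (g (dyad j m) l) r u + root_in (g (dyad j.+1 m) l) r u))%N.
have H u : (\sum_(e < 8) drop_at c (dyad (u * 8 + e) (r + 3)) m j <=
            8 * drop_at c (dyad u r) m j + 8 * k * bad u)%N.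
  have [bu|bu] := posnP (bad u); last first.
    apply: (@leq_trans (8 * k * bad u)); last exact: leq_addl.
    apply: (@leq_trans (\sum_(e < 8) k)); last by rewrite sum_nat_const card_ord leq_pmulr.
    by apply: leq_sum => e _; exact: drop_at_le.
  apply: leq_trans (leq_addr _ _); rewrite -[X in (_ <= X * _)%N]card_ord -sum_nat_const.
  apply: leq_sum => e _.
  have ux : dyad u r <= dyad (u * 8 + e) (r + 3).
    by rewrite -(dyad_mul u r 3) (addnC 3 r) dyad_le mulnC leq_addr.
  have xu : dyad (u * 8 + e) (r + 3) < dyad u.+1 r.
    by rewrite -(dyad_mul u.+1 r 3) (addnC 3 r) dyad_lt; have := ltn_ord e; lia.
  have nb y : (y = dyad j m \/ y = dyad j.+1 m) ->
      svarc c (dyad u r) y = svarc c (dyad (u * 8 + e) (r + 3)) y.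
    move=> yy; apply: contrapT => /(svarc_change ux)[l lk [g0 [z /andP[z1 z2] rz]]].
    move/eqP: bu; rewrite sum_nat_eq0 => /forallP/(_ (Ordinal (lk : (l < k.+1)%N))).
    rewrite /= addn_eq0 !eqb0 => /andP[N1 N2].
    have B : root_in (g y l) r u.
      by apply/asboolP; split=> //; exists z => //; rewrite z1 (le_lt_trans z2).
    by case: yy => e'; rewrite -e' B in N1 N2.
  by rewrite /drop_at (nb _ (or_introl erefl)) (nb _ (or_intror erefl)).
apply: (@leq_trans (\sum_(a <= u < b) (8 * drop_at c (dyad u r) m j + 8 * k * bad u))).
  by apply: leq_sum => u _; exact: H.
rewrite big_split /= -!big_distrr /= leq_add2l.
have -> : (16 * k * k * k.+1 = 8 * k * (k.+1 * (k + k)))%N by lia.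
rewrite leq_mul2l exchange_big /=; apply/orP; right.
rewrite -[X in (_ <= X * _)%N]card_ord -sum_nat_const.
apply: leq_sum => l _; rewrite big_split /=.
by apply: leq_add; apply: root_blocks; exact: size_cpoly.
Qed.

(** Columns are sampled at the left ends of their blocks, rows at both ends of every cell, hence the
    extra row. *)
Definition sample_forms r m : seq 'Hom('M[R]_k.+1, R^o) :=
  [seq sample_form k (dyad p.1 r) (dyad p.2 m) l
     | p <- [seq (u, v) | u <- iota 0 (2 ^ r), v <- iota 0 (2 ^ m).+1], l <- iota 0 k.+1].

Lemma size_sample_forms r m :
  size (sample_forms r m) = (2 ^ r * (2 ^ m).+1 * k.+1)%N.
Proof. by rewrite !size_allpairs !size_iota. Qed.

Lemma cnt_ext r m c c' i j : (m <= r)%N -> (i < 2 ^ m)%N -> (j < 2 ^ m)%N ->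
  same_signs (sample_forms r m) c c' -> cnt r m c i j = cnt r m c' i j.
Proof.
move=> mr im jm H; apply: eq_big_nat => u /andP[_ ui].
have ur : (u < 2 ^ r)%N.
  have e : (2 ^ r = 2 ^ m * 2 ^ (r - m))%N by rewrite -expnD subnKC.
  by rewrite (leq_trans ui)// e leq_mul2r im orbT.
have E v : (v <= 2 ^ m)%N -> svarc c (dyad u r) (dyad v m) = svarc c' (dyad u r) (dyad v m).
  move=> vm; apply: svarc_ext => l lk; apply: H.
  apply/allpairsP; exists ((u, v), l); split=> //; last by rewrite mem_iota add0n ltnS.
  by apply/allpairsP; exists (u, v); split=> //; rewrite mem_iota add0n ?ltnS.
by rewrite /drop_at !E// ltnW.
Qed.

End Counting.

(** * Cells near a curve *)

Lemma leq_sum_subrange (F : nat -> nat) a0 a b b0 :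
  (a0 <= a)%N -> (b <= b0)%N -> (forall u, (a <= u < b)%N -> (0 < F u)%N) ->
  (b - a <= \sum_(a0 <= u < b0) F u)%N.
Proof.
move=> a0a bb0 H; have [ba|ab] := leqP b a.
  by rewrite (_ : (b - a = 0)%N)//; apply/eqP; rewrite subn_eq0.
rewrite (@big_cat_nat _ _ _ a)//=; last exact: leq_trans (ltnW ab) bb0.
rewrite (@big_cat_nat _ _ _ b a)//=; last exact: ltnW.
apply: leq_trans (leq_addl _ _); apply: leq_trans (leq_addr _ _).
rewrite -[(b - a)%N]muln1 -sum_nat_const_nat !big_nat.
by apply: leq_sum => u /H.
Qed.

Section Hits.
Variables (R : rcfType) (k : nat).
Implicit Types (c : 'M[R]_k.+1) (x y : R) (r m u i j : nat).

(** The transposed terms count roots of the y-derivatives along rows, which is where [svarc] can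
    change from one column to another. *)
Definition charge r m c i j :=
  (cnt r m c i j + \sum_(l < k.+1) cnt r m (iter l (@dmx R k) c)^T j i)%N.

(** A horizontal line inside the curve is a common root of all rows of [c], one of which is a
    nonzero polynomial of degree at most [k]. *)
Lemma zero_columns r c a b : c != 0 ->
  (\sum_(a <= v < b) (cpoly c^T (dyad R v r) == 0)%R <= k)%N.
Proof.
move=> c0.
have [i ri0] : exists i : 'I_k.+1, row i c != 0.
  apply: contrapT => H; move/negP: c0; apply; apply/eqP/row_matrixP => i'.
  by rewrite row0; apply: contrapT => /eqP ?; apply: H; exists i'.
have p0 : rVpoly (row i c) != 0.
  by apply: contra ri0 => /eqP e; rewrite -[row i c]rVpolyK e linear0.
apply: leq_trans (@root_blocks R k (rVpoly (row i c)) r a b (size_poly _ _)).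
apply: leq_sum => v _; case: eqP => // e.
suff -> : root_in (rVpoly (row i c)) r v by [].
apply/asboolP; split=> //; exists (dyad R v r); first by rewrite lexx dyad_lt /=.
apply/rootP; rewrite (horner_coef_wide _ (size_poly _ _)).
have := congr1 (fun p : {poly R} => p`_i) e.
rewrite coef0 coef_rVpoly_ord mxE => e'; rewrite -[RHS]e'.
by apply: eq_bigr => l _; rewrite coef_rVpoly_ord !mxE mulrC.
Qed.

(* Through a zero near the centre of the cell, either the columns just to its
   right all see a drop of svarc inside the cell, or many rows see a change of
   svarc along the row, hence a root of some derivative in y. *)
Lemma charge_hit r m c i j x0 y0 : c != 0 -> (m + 3 <= r)%N ->
  (k <= 2 ^ (r - m - 3))%N -> (cpoly c x0).[y0] = 0 ->
  dyad R (8 * i + 4) (m + 3) <= x0 <= dyad R (8 * i + 5) (m + 3) ->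
  dyad R (8 * j + 4) (m + 3) <= y0 <= dyad R (8 * j + 5) (m + 3) ->
  (2 ^ (r - m - 3) <= charge r m c i j)%N.
Proof.
move=> c0 mr kg z0 /andP[x1 x2] /andP[y1 y2].
set g := (2 ^ (r - m - 3))%N in kg *.
have g0 : (0 < g)%N by rewrite /g expn_gt0.
have e8 : (2 ^ (r - m) = 8 * g)%N by rewrite -(expnD 2 3); congr expn; lia.
have dyg u : dyad R (u * g) r = dyad R u (m + 3).
  by rewrite mulnC -(dyad_mul R u (m + 3) (r - m - 3)); congr dyad; lia.
have dyc u : dyad R (8 * u) (m + 3) = dyad R u m.
  by rewrite -(dyad_mul R u m 3) (addnC 3).
have xi : dyad R i m < x0 <= dyad R i.+1 m.
  rewrite -!dyc (lt_le_trans _ x1) ?(le_trans x2) ?dyad_le ?dyad_lt//; lia.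
(* If the curve contains the vertical line through [x0], every row of the cell has a root at [x0],
   and all but at most [k] rows are not identically zero; the transposed count of order 0 is then
   large enough. *)
have [cx0|cx0] := eqVneq (cpoly c x0) 0.
  apply: leq_trans (leq_addl _ _); rewrite (bigD1 ord0)//=.
  apply: leq_trans (leq_addr _ _).
  have zc := @zero_columns r c (j * 2 ^ (r - m)) (j.+1 * 2 ^ (r - m)) c0.
  rewrite -(leq_add2r k); apply: (@leq_trans (8 * g)); first by lia.
  apply: leq_trans (leq_add (leqnn _) zc); rewrite -big_split /=.
  apply: (@leq_trans (j.+1 * 2 ^ (r - m) - j * 2 ^ (r - m))).
    by rewrite mulSn addnK e8.
  apply: leq_sum_subrange => // v _.
  have [e|ne] := eqVneq (cpoly c^T (dyad R v r)) 0; first by rewrite addn1.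
  rewrite addn0 /drop_at subn_gt0; apply: (@svarc_lt _ _ _ _ _ _ x0) => //.
  by rewrite cpoly_tr cx0 horner0.
(* A row is good if [svarc] agrees on column [x0] and on all sampled columns in the right three
   eighths of the cell. A bad row contributes to the transposed counts, so an eighth of the cell
   filled with bad rows suffices. *)
pose good v := forall u, ((8 * i + 5) * g <= u < (8 * i + 8) * g)%N ->
  svarc c (dyad R u r) (dyad R v r) = svarc c x0 (dyad R v r).
have xu u : ((8 * i + 5) * g <= u)%N -> x0 <= dyad R u r.
  by move=> H; apply: (le_trans x2); rewrite -dyg dyad_le.
have badP v : ~ good v ->
    (0 < \sum_(l < k.+1) drop_at (iter l (@dmx R k) c)^T (dyad R v r) m i)%N.
  move=> /existsNP[u] /not_implyP[/andP[u1 u2] ne].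
  have [l lk [q0 [z /andP[z1 z2] rz]]] := svarc_change (xu u u1) (nesym ne).
  rewrite (bigD1 (Ordinal (lk : (l < k.+1)%N)))//= addn_gt0; apply/orP; left.
  rewrite /drop_at subn_gt0; apply: (@svarc_lt _ _ _ _ _ _ z) => //; last exact/rootP.
  case/andP: xi => xi1 _; rewrite (lt_le_trans xi1 z1) (le_trans z2)//.
  by rewrite -dyc -dyg dyad_le; lia.
have many a b : (8 * j <= a)%N -> (b <= 8 * j + 8)%N -> (a < b)%N ->
    (forall v, (a * g <= v < b * g)%N -> ~ good v) -> (g <= charge r m c i j)%N.
  move=> ja bj ab bad; apply: leq_trans (leq_addl _ _).
  rewrite exchange_big /= e8 !mulnA.
  apply: (@leq_trans (b * g - a * g)); first by rewrite -mulnBl leq_pmull// subn_gt0.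
  by apply: leq_sum_subrange => [||v /bad/badP//]; rewrite leq_mul2r; lia.
have [allbad|] := pselect (forall v, (8 * j * g <= v < (8 * j + 4) * g)%N -> ~ good v).
  by apply: (many (8 * j)%N (8 * j + 4)%N) => //; lia.
move=> /existsNP[v1] /not_implyP[/andP[v1j v1y] /contrapT good1].
have [allbad|] := pselect (forall v, ((8 * j + 5) * g <= v < (8 * j + 8) * g)%N -> ~ good v).
  by apply: (many (8 * j + 5)%N (8 * j + 8)%N) => //; lia.
move=> /existsNP[v2] /not_implyP[/andP[v2y v2j] /contrapT good2].
(* There are now good rows [v1] below and [v2] above [y0]. The root [y0] makes [svarc] drop between
   them on column [x0], hence also on each column in the right three eighths. *)
apply: leq_trans (leq_addr _ _); rewrite /cnt e8.
apply: (@leq_trans ((8 * i + 8) * g - (8 * i + 5) * g)).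
  by rewrite -mulnBl leq_pmull//; lia.
apply: leq_sum_subrange => [||u uI]; rewrite ?mulnA ?leq_mul2r ?mulnS; try lia.
rewrite /drop_at subn_gt0.
have H1 : dyad R j m <= dyad R v1 r.
  apply: le_trans (_ : dyad R (8 * j * g) r <= _); last by rewrite dyad_le; lia.
  by rewrite dyg dyc.
have H2 : dyad R v2 r <= dyad R j.+1 m. by rewrite -dyc -dyg dyad_le; lia.
apply: leq_ltn_trans (svarc_le c _ H2) _; apply: leq_trans _ (svarc_le c _ H1).
rewrite good1// good2//; apply: svarc_lt cx0 _ z0.
rewrite (lt_le_trans _ y1)/=; last by rewrite -dyg dyad_lt.
by rewrite (le_trans y2)// -dyg dyad_le.
Qed.

(** * Moving zeros to the centre of a cell by translations *)

Definition translate a b c := (tmx (- a) (tmx (- b) c)^T)^T.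

Lemma cpoly_translate a b c x y : (cpoly (translate a b c) (x + a)).[y + b] = (cpoly c x).[y].
Proof. by rewrite /translate cpoly_tr cpoly_tmx addrK cpoly_tr cpoly_tmx addrK. Qed.

Lemma translate_neq0 a b c : c != 0 -> translate a b c != 0.
Proof.
apply: contra => /eqP/(congr1 (@trmx _ _ _)); rewrite trmxK trmx0.
move=> /tmx_eq0/(congr1 (@trmx _ _ _)); rewrite trmxK trmx0.
by move=> /tmx_eq0 ->.
Qed.

(** After scaling by 2^m, the zero lies in the open 3 by 3 block of cells around [q]; this block
    contains all points at distance less than a cell side from the cell. *)
Definition near_cell m c (q : nat * nat) := exists x y,
  [/\ (cpoly c x).[y] = 0, q.1%:R - 1 < 2 ^+ m * x < q.1%:R + 2 &
      q.2%:R - 1 < 2 ^+ m * y < q.2%:R + 2].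

Definition centered m c (q : nat * nat) := exists x y,
  [/\ (cpoly c x).[y] = 0,
      dyad R (8 * q.1 + 4) (m + 3) <= x <= dyad R (8 * q.1 + 5) (m + 3) &
      dyad R (8 * q.2 + 4) (m + 3) <= y <= dyad R (8 * q.2 + 5) (m + 3)].

(** A translation by between -12 and 12 eighths of a cell side. One of these brings any coordinate
    of the block of width 3 into the fifth eighth of the central cell. *)
Definition eighth m (a : nat) : R := (a%:R - 12) / (2 ^+ (m + 3)).

Lemma grid_shift m i x : i%:R - 1 < 2 ^+ m * x < i%:R + 2 ->
  exists2 a, (a < 25)%N &
    dyad R (8 * i + 4) (m + 3) <= x + eighth m a <= dyad R (8 * i + 5) (m + 3).
Proof.
move=> /andP[x1 x2].
pose P a := 8 * i%:R + 4 <= 8 * (2 ^+ m * x) + (a%:R - 12).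
have exP : exists a, P a by exists 24%N; rewrite /P; lra.
case: (ex_minnP exP) => a Pa amin.
have a23 : (a <= 24)%N by apply: amin; rewrite /P; lra.
exists a => //.
have a0 : (0 < a)%N.
  by rewrite lt0n; apply: contraTN Pa => /eqP ->; rewrite /P -ltNge; lra.
have Pa' : 8 * (2 ^+ m * x) + (a%:R - 12) < 8 * i%:R + 5.
  have : ~~ P a.-1 by apply/negP => /amin; lia.
  by rewrite /P -ltNge -(prednK a0) -natr1 /=; lra.
have e0 : 0 < 2 ^+ (m + 3) :> R by rewrite exprn_gt0.
have ex : x + eighth m a = (8 * (2 ^+ m * x) + (a%:R - 12)) / 2 ^+ (m + 3).
  apply/(canRL (mulfK (lt0r_neq0 e0))); rewrite /eighth mulrDl (divfK (lt0r_neq0 e0)).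
  by rewrite exprD; ring.
have n8 n : (8 * i + n)%:R = 8 * i%:R + n%:R :> R by rewrite natrD natrM.
by rewrite ex /dyad !ler_pM2r ?invr_gt0// !n8; apply/andP; split=> //; exact: ltW.
Qed.

Lemma near_centered m c q : near_cell m c q ->
  exists ab : 'I_25 * 'I_25, centered m (translate (eighth m ab.1) (eighth m ab.2) c) q.
Proof.
move=> [x [y [z /grid_shift[a a24 xa] /grid_shift[b b24 yb]]]].
exists (Ordinal a24, Ordinal b24), (x + eighth m a), (y + eighth m b).
by rewrite cpoly_translate.
Qed.

Definition ocnt (o : bool) r m c (q : nat * nat) :=
  if o then cnt r m c q.1 q.2 else cnt r m c q.2 q.1.

(** Each cell near the curve is charged at least 2^(r - m - 3) by one of the 25 * 25 translates, and
    a charge is a sum of k + 2 counts. The bound [Y] must hold for all polynomials, since translates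
    and derivatives are counted too. *)
Lemma near_count r m c (s : seq (nat * nat)) Y : c != 0 -> (m + 3 <= r)%N ->
  (k <= 2 ^ (r - m - 3))%N ->
  (forall o c, (\sum_(q <- s) ocnt o r m c q <= Y)%N) ->
  (2 ^ (r - m - 3) * count (fun q => `[< near_cell m c q >]) s <= 25 * 25 * (k.+2 * Y))%N.
Proof.
move=> c0 mr kg HY; rewrite -sum1_count big_mkcond/= big_distrr/=.
pose sh (ab : 'I_25 * 'I_25) := translate (eighth m ab.1) (eighth m ab.2) c.
apply: (@leq_trans (\sum_(q <- s) \sum_ab charge r m (sh ab) q.1 q.2)).
  apply: leq_sum => q _; case: asboolP => [|_]; last by rewrite muln0.
  move=> /near_centered[ab [x [y [z xq yq]]]]; rewrite muln1 (bigD1 ab)//=.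
  apply: leq_trans (leq_addr _ _).
  by apply: (charge_hit _ mr kg z xq yq); exact: translate_neq0.
rewrite exchange_big /=.
have -> : (25 * 25 = #|{: 'I_25 * 'I_25}|)%N by rewrite card_prod !card_ord.
rewrite -sum_nat_const; apply: leq_sum => ab _.
rewrite big_split/= mulSn leq_add//; first exact: (HY true).
rewrite exchange_big/= -[X in (_ <= X * _)%N]card_ord -sum_nat_const.
by apply: leq_sum => l _; exact: (HY false).
Qed.
End Hits.

(** * Choosing one child per cell *)

Lemma dependent_choice_nat (T : Type) (P : nat -> T -> Prop)
    (Q : nat -> T -> T -> Prop) (x0 : T) :
  P 0%N x0 -> (forall m x, P m x -> exists2 y, P m.+1 y & Q m x y) ->
  exists f : nat -> T, [/\ f 0%N = x0, forall m, P m (f m) & forall m, Q m (f m) (f m.+1)].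
Proof.
move=> P0 H.
have [F HF] : exists F : nat -> T -> T, forall m x, P m x -> P m.+1 (F m x) /\ Q m x (F m x).
  have H' (mx : nat * T) : exists y, P mx.1 mx.2 -> P mx.1.+1 y /\ Q mx.1 mx.2 y.
    have [/H[y Py Qy]|nP] := pselect (P mx.1 mx.2); first by exists y.
    by exists mx.2.
  by have [F HF] := boolp.choice H'; exists (fun m x => F (m, x)) => m x /(HF (m, x)).
pose f := fix f m := if m is m'.+1 then F m' (f m') else x0.
have Pf m : P m (f m) by elim: m => //= m /HF[].
by exists f; split=> // m; have [] := HF _ _ (Pf m).
Qed.

Definition child (q : nat * nat) (b : bool * bool) : nat * nat :=
  ((2 * q.1 + b.1)%N, (2 * q.2 + b.2)%N).

Definition parent (q : nat * nat) : nat * nat := (q.1./2, q.2./2).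

Lemma parentK q b : parent (child q b) = q.
Proof. by case: q b => i j [[] []]; rewrite /parent /child /=; congr pair; lia. Qed.

Lemma child_inj q : injective (child q).
Proof.
move=> [a1 a2] [b1 b2] [/addnI e1 /addnI e2].
by case: a1 b1 a2 b2 e1 e2 => [] [] [] [].
Qed.

Definition in_range m (q : nat * nat) := (q.1 < 2 ^ m)%N && (q.2 < 2 ^ m)%N.

Lemma in_range_child m q b : in_range m q -> in_range m.+1 (child q b).
Proof.
by rewrite /in_range !expnS; case: q b => i j [[] []] /= /andP[]; lia.
Qed.

Section Derandomization.
Variable R : realFieldType.

Lemma exists_le_average (F : bool * bool -> R) y :
  \sum_b F b <= 4 * y -> exists b, F b <= y.
Proof.
move=> H; apply: contrapT => /forallNP N.
have lt b : y < F b by rewrite ltNge; apply/negP.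
suff : 4 * y < \sum_b F b by rewrite ltNge H.
have -> : 4 * y = \sum_(b : bool * bool) y.
  by rewrite sumr_const card_prod !card_bool mulr_natl.
by apply: ltr_sum => [|b _]; [apply/hasP; exists (true, true); rewrite ?mem_index_enum|].
Qed.

(** Method of conditional expectations: one cell at a time, some child makes the potential at most
    its mean over the four children, with the remaining cells still averaged. *)
Lemma greedy_choice (T : Type) (W : seq T) (s : seq (nat * nat)) (a : T -> R)
    (z : T -> nat * nat -> bool * bool -> R) : uniq s ->
  (forall w, 0 <= a w) -> (forall w q b, 0 <= z w q b) ->
  exists f : nat * nat -> bool * bool,
    \sum_(w <- W) a w * \prod_(q <- s) (1 + z w q (f q)) <=
    \sum_(w <- W) a w * \prod_(q <- s) (1 + (\sum_b z w q b) / 4).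
Proof.
elim: s a => [|q s IH] a; first by exists (fun=> (true, true)); apply: ler_sum => w _;
  rewrite !big_nil.
move=> /= /andP[qs us] a0 z0.
pose P w := \prod_(q <- s) (1 + (\sum_b z w q b) / 4).
have [b Hb] : exists b, \sum_(w <- W) (a w * (1 + z w q b)) * P w <=
    \sum_(w <- W) a w * \prod_(q <- q :: s) (1 + (\sum_b z w q b) / 4).
  apply: exists_le_average; rewrite exchange_big mulr_sumr /=.
  apply: ler_sum => w _; rewrite big_cons -/(P w).
  rewrite -mulr_suml -mulr_sumr big_split /= sumr_const card_prod !card_bool.
  by rewrite le_eqVlt; apply/orP; left; apply/eqP; have -> : 1 *+ (2 * 2) = 4 :> R by []; field.
have [|f Hf] := IH (fun w => a w * (1 + z w q b)) us _ z0.
  by move=> w; rewrite mulr_ge0// addr_ge0.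
exists (fun q' => if q' == q then b else f q').
apply: le_trans Hb; apply: le_trans Hf.
apply: ler_sum => w _; rewrite big_cons eqxx mulrA ler_wpM2l ?mulr_ge0 ?addr_ge0//.
rewrite le_eqVlt; apply/orP; left; apply/eqP; apply: eq_big_seq => q' q's.
by case: eqP => // e; rewrite e (negPf qs) in q's.
Qed.
End Derandomization.

Section Tree.
Variables (R : realType) (k : nat).
Implicit Types (c : 'M[R]_k.+1) (s : seq (nat * nat)) (r m : nat).

Lemma ocnt_split o r m c q : (m < r)%N ->
  (ocnt o r m c q = \sum_b ocnt o r m.+1 c (child q b))%N.
Proof.
move=> mr; rewrite -(pair_bigA _ (fun b1 b2 => ocnt o r m.+1 c (child q (b1, b2)))) /=.
rewrite !big_bool /ocnt /child /= !addn1 !addn0.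
by case: o; rewrite (cnt_split _ _ _ mr); lia.
Qed.

Lemma ocnt_le o r m c q : (ocnt o r m c q <= 2 ^ (r - m) * k)%N.
Proof. by rewrite /ocnt; case: o; exact: cnt_le. Qed.

Lemma ocnt_ext o r m c c' q : (m <= r)%N -> in_range m q ->
  same_signs (sample_forms R k r m) c c' -> ocnt o r m c q = ocnt o r m c' q.
Proof.
by move=> mr /andP[q1 q2] H; rewrite /ocnt; case: o; apply: cnt_ext.
Qed.

(* The logarithm of a bound for the number of sign patterns of the samples. *)
Definition entropy r m : R := ((r + m + k + 6) * k.+1 ^ 2 + 1)%:R.

Lemma two_expR n : (2 ^ n)%:R <= expR n%:R :> R.
Proof.
rewrite natrX -[X in expR X]mulr1 expRM_natl.
by rewrite lerXn2r ?nnegrE ?expR_ge0//; exact: (expR_ge1Dx 1).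
Qed.

(** The exponent is the dimension (k + 1)^2 of the coefficient space; the factor 2 counts the two
    coordinate directions. *)
Lemma size_sign_reps r m (L : seq 'M[R]_k.+1) :
  (size L <= (3 * size (sample_forms R k r m.+1) + 1) ^ \dim {:'M[R]_k.+1})%N ->
  (2 * size L)%:R <= expR (entropy r m).
Proof.
rewrite size_sample_forms dimvf /dim /= => sL; apply: le_trans (two_expR _).
rewrite ler_nat addn1 expnS leq_mul2l /= (leq_trans sL)// mulnn expnM.
have le_exp a b e : (a <= b)%N -> (a ^ e <= b ^ e)%N by case: e => // e; rewrite leq_exp2r.
apply: le_exp.
have kk := ltn_expl k (isT : (1 < 2)%N).
have m2 : ((2 ^ m.+1).+1 <= 2 ^ m.+2)%N by rewrite (expnS 2 m.+1) mul2n -addnn -addn1 leq_add2l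
  expn_gt0.
apply: (@leq_trans (4 * (2 ^ r * 2 ^ m.+2 * 2 ^ k))).
  have : (2 ^ r * (2 ^ m.+1).+1 * k.+1 <= 2 ^ r * 2 ^ m.+2 * 2 ^ k)%N.
    exact: leq_mul (leq_mul (leqnn _) m2) kk.
  have : (0 < 2 ^ r * 2 ^ m.+2 * 2 ^ k)%N by rewrite -!expnD expn_gt0.
  lia.
rewrite -!expnD -(expnD 2 2) leq_pexp2l//; lia.
Qed.

(* Finitely many sign patterns occur, so the potential argument controls all
   polynomials and both coordinate directions at once. *)
Lemma one_child_step r m s eps : uniq s -> all (in_range m) s -> (m < r)%N -> 0 < eps ->
  exists f : nat * nat -> bool * bool, forall o c,
    4 * (\sum_(q <- s) ocnt o r m.+1 c (child q (f q)))%:R <=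
    (1 + eps) * ((\sum_(q <- s) ocnt o r m c q)%:R +
                 entropy r m * (2 * k.+1%:R * 2 ^+ (r - m)) / eps) :> R.
Proof.
move=> us sr mr e0.
have [L sL HL] := sign_reps (sample_forms R k r m.+1) fullv.
pose W := [seq (o, c) | o <- [:: true; false], c <- L].
have sW : (size W)%:R <= expR (entropy r m).
  by rewrite size_allpairs /=; exact: size_sign_reps.
(* The parameter of the exponential moments, chosen so that every [z] is at most [eps]; [k.+1] keeps
   the denominator nonzero for k = 0. *)
pose t : R := eps / (2 * k.+1%:R * 2 ^+ (r - m)).
have k0 : 0 < 2 * k.+1%:R * 2 ^+ (r - m) :> R.
  by rewrite mulr_gt0 ?exprn_gt0// mulr_gt0// ltr0n.
have t0 : 0 < t by rewrite divr_gt0.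
pose z (w : bool * 'M[R]_k.+1) q b := 4 * t * (ocnt w.1 r m.+1 w.2 (child q b))%:R.
have z0 w q b : 0 <= z w q b.
  by apply: mulr_ge0 => //; apply: mulr_ge0 => //; exact: ltW.
have zeps w q b : z w q b <= eps.
  rewrite /z (_ : 4 * t * _ = (4 * (ocnt w.1 r m.+1 w.2 (child q b))%:R) * eps / (2 * k.+1%:R *
    2 ^+ (r - m))); last by rewrite /t; ring.
  rewrite ler_pdivrMr// [leRHS]mulrC.
  apply: ler_wpM2r; first exact: ltW.
  apply: (@le_trans _ _ (4 * (2 ^ (r - m.+1) * k)%:R)).
    by rewrite ler_wpM2l// ler_nat; exact: ocnt_le.
  rewrite -natrX -!natrM ler_nat.
  have -> : (2 ^ (r - m) = 2 * 2 ^ (r - m.+1))%N by rewrite -expnS; congr expn; lia.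
  by nia.
have zavg w q : (\sum_b z w q b) / 4 = t * (ocnt w.1 r m w.2 q)%:R.
  rewrite -mulr_sumr (ocnt_split _ _ _ mr) natr_sum.
  by move: (\sum_(i <- _) _) => S; field.
pose P w := \prod_(q <- s) (1 + (\sum_b z w q b) / 4).
have P0 w : 0 < P w.
  by apply: prodr_gt0 => q _; rewrite ltr_pwDl// divr_ge0// sumr_ge0.
(* Weighting each pattern by the inverse of its mean makes the initial potential equal to the number
   of patterns, so every single product ends up at most exp(entropy) times its mean. *)
have [f Hf] := @greedy_choice _ _ W s (fun w => (P w)^-1) z us
  (fun w => ltW (etrans (invr_gt0 _) (P0 w))) z0.
have {}Hf w : w \in W ->
    \prod_(q <- s) (1 + z w q (f q)) <= expR (entropy r m) * P w.
  move=> wW; rewrite mulrC -ler_pdivrMl//.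
  apply: le_trans (le_trans Hf _); last first.
    apply: le_trans sW; rewrite -sum1_size natr_sum.
    by apply: ler_sum => w' _; rewrite mulVf// gt_eqF.
  rewrite (big_rem w wW)/= lerDl; apply: sumr_ge0 => w' _.
  rewrite mulr_ge0 ?invr_ge0 ?(ltW (P0 _))//.
  by apply: prodr_ge0 => q _; rewrite addr_ge0.
(* An arbitrary polynomial is replaced by the representative of its signs at level m + 1; its counts
   at level [m] agree as well, being sums over children. *)
exists f => o c; have [c' c'L [_ Hs]] := HL c (memvf c).
have e1 : (\sum_(q <- s) ocnt o r m.+1 c (child q (f q)) =
           \sum_(q <- s) ocnt o r m.+1 c' (child q (f q)))%N.
  apply: eq_big_seq => q /(allP sr) qs; apply/esym/ocnt_ext => //.
  exact: in_range_child.
have e2 : (\sum_(q <- s) ocnt o r m c q = \sum_(q <- s) ocnt o r m c' q)%N.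
  apply: eq_big_seq => q /(allP sr) qs; rewrite !ocnt_split//.
  by apply: eq_bigr => b _; apply/esym/ocnt_ext => //; exact: in_range_child.
have wW : (o, c') \in W by apply: allpairs_f => //; case: (o); rewrite !inE.
rewrite e1 e2; move: (Hf _ wW); set w := (o, c').
set S1 := (\sum_(q <- s) _)%N; set S2 := (\sum_(q <- s) _)%N => HfW.
(* For 0 <= z <= eps one has 1 + z >= exp(z / (1 + eps)), because 1 / (1 + z) <= 1 - z / (1 +
   eps). *)
have lo : expR (4 * t * S1%:R / (1 + eps)) <= \prod_(q <- s) (1 + z w q (f q)).
  rewrite natr_sum mulr_sumr mulr_suml expR_sum.
  apply: ler_prod => q _; rewrite expR_ge0 /=.
  have zp : 0 < 1 + z w q (f q) by rewrite ltr_pwDl.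
  rewrite -[leRHS]invrK -[leLHS]invrK -expRN lef_pV2 ?posrE ?invr_gt0 ?expR_gt0//.
  apply: le_trans (expR_ge1Dx _); rewrite -/(z w q (f q)).
  rewrite -(ler_pM2r zp) mulVf ?gt_eqF// mulrDl mul1r mulNr -/w.
  have : z w q (f q) / (1 + eps) * (1 + z w q (f q)) <= z w q (f q).
    rewrite -mulrA ler_piMr// mulrC ler_pdivrMr ?mul1r ?lerD2l ?zeps//.
    by rewrite ltr_pwDl// ltW.
  lra.
have hi : P w <= expR (t * S2%:R).
  rewrite natr_sum mulr_sumr expR_sum; apply: ler_prod => q _.
  rewrite zavg expR_ge1Dx andbT; apply: addr_ge0 => //.
  by apply: mulr_ge0 => //; exact: ltW.
have := le_trans lo (le_trans HfW (ler_wpM2l (expR_ge0 _) hi)).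
rewrite -expRD ler_expR ler_pdivrMr; last by rewrite ltr_pwDl// ltW.
move=> H; rewrite -(ler_pM2l t0).
have -> : t * (4 * S1%:R) = 4 * t * S1%:R by ring.
apply: le_trans H _; rewrite le_eqVlt; apply/orP; left; apply/eqP.
by rewrite /t; field; rewrite nat1r pnatr_eq0 !gt_eqF ?exprn_gt0.
Qed.
End Tree.

(** * The tree of cells *)

Definition bnum (b : bool) : nat := if b then 4 else 1.

Definition tsize (br : nat -> bool) m : nat := \prod_(i < m) bnum (br i).

Definition subcells (ch : nat * nat -> seq (bool * bool)) (s : seq (nat * nat)) :=
  [seq child q b | q <- s, b <- ch q].

Lemma subcells_uniq ch s : uniq s -> (forall q, uniq (ch q)) -> uniq (subcells ch s).
Proof.
move=> us uch; apply: allpairs_uniq_dep => // -[q b] [q' b'] _ _ /= e.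
have eq : q = q' by rewrite -(parentK q b) e parentK.
by move: e; rewrite eq => /child_inj ->.
Qed.

Lemma subcells_in_range ch s m : all (in_range m) s -> all (in_range m.+1) (subcells ch s).
Proof.
move=> /allP H; apply/allP => _ /allpairsPdep[q [b [/H qs _ ->]]].
exact: in_range_child.
Qed.

Lemma subcells_parent ch s q : q \in subcells ch s -> parent q \in s.
Proof. by move=> /allpairsPdep[p [b [ps _ ->]]]; rewrite parentK. Qed.

Lemma subcells_count ch s q n : uniq s -> q \in s -> (forall p, size (ch p) = n) ->
  count (fun p => parent p == q) (subcells ch s) = n.
Proof.
move=> us qs sch; rewrite -sum1_count big_mkcond/= big_allpairs_dep/=.
rewrite (bigD1_seq q)//= [X in (_ + X)%N]big1 => [|p pq].
  rewrite /= addn0 (eq_bigr (fun=> 1%N)); first by rewrite sum1_size.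
  by move=> b _; rewrite parentK eqxx.
by rewrite big1_seq// => b _; rewrite parentK (negPf pq).
Qed.

Lemma size_subcells ch s n : (forall p, size (ch p) = n) -> size (subcells ch s) = (size s * n)%N.
Proof.
move=> sch; rewrite /subcells size_allpairs_dep -(sum1_size s) big_distrl sumnE big_map /=.
by apply: eq_bigr => q _; rewrite sch mul1n.
Qed.

Section TreeConstruction.
Variables (R : realType) (k : nat).
Implicit Types (c : 'M[R]_k.+1) (s : seq (nat * nat)) (r m : nat).

Lemma refinement_exists (b : bool) r m s eps : uniq s -> all (in_range m) s -> (m < r)%N ->
  0 < eps -> exists ch : nat * nat -> seq (bool * bool),
    [/\ forall q, uniq (ch q), forall q, size (ch q) = bnum b &
    forall o c, 4 * (\sum_(q <- subcells ch s) ocnt o r m.+1 c q)%:R <=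
    (bnum b)%:R * ((1 + eps) * ((\sum_(q <- s) ocnt o r m c q)%:R +
                 entropy R k r m * (2 * k.+1%:R * 2 ^+ (r - m)) / eps)) :> R].
Proof.
move=> us sr mr e0; case: b.
  exists (fun=> enum {: bool * bool}); split=> [q|q|o c]; first exact: enum_uniq.
    by rewrite -cardE card_prod !card_bool.
  rewrite ler_wpM2l// /subcells big_allpairs_dep/=.
  rewrite (eq_bigr (fun q => ocnt o r m c q)); last first.
    by move=> q _; rewrite big_enum (ocnt_split _ _ _ mr).
  set S : R := _%:R; set T := _ / eps.
  have T0 : 0 <= T.
    by rewrite /T divr_ge0 ?mulr_ge0 ?exprn_ge0 ?ler0n// ltW.
  have S0 : 0 <= S by rewrite ler0n.
  rewrite -[leLHS]mul1r; apply: ler_pM => //; rewrite lerDl //; exact: ltW.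
have [f Hf] := @one_child_step R k r m s eps us sr mr e0.
exists (fun q => [:: f q]); split=> // o c.
rewrite mul1r; apply: le_trans (Hf o c); rewrite ler_wpM2l// ler_nat.
rewrite /subcells big_allpairs_dep/=; apply: leq_sum => q _.
by rewrite big_seq1.
Qed.

(** Three binary digits per level, as added by [cnt_refine], make the relative refinement error of
    order 2^-m; the constant k + 3 gives k <= 2^(r - m - 3) at every level. *)
Definition sample_res m := (3 * m + (k + 3))%N.

Definition entropy_const : R := ((2 * k + 15) * k.+1 ^ 2 + 1)%:R.
Definition deviation_const : R := 2 * k.+1%:R * entropy_const.
Definition refine_const : R := (16 * k ^ 2 * k.+1)%:R.

Definition eta (eps : nat -> R) i : R := eps i + deviation_const * eps i + refine_const / 2 ^+ i.

Definition charge_bound (eps : nat -> R) m : R := k.+1%:R * expR (\sum_(i < m) eta eps i).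

(** All 4^m cells together have counts of order 2^r, so a proportional share for N cells is N 2^r /
    4^m. The subtracted 1 leaves room for the additive errors of each step. *)
Definition balanced br eps m s := [/\ uniq s, all (in_range m) s, size s = tsize br m &
  forall o c, (\sum_(q <- s) ocnt o (sample_res m) m c q)%:R <=
    (charge_bound eps m - 1) * (tsize br m)%:R * 2 ^+ sample_res m / 4 ^+ m].

(** Carrying B + 1 instead of B turns the recursion with additive errors [d] and [t] into a purely
    multiplicative one. *)
Lemma growth_step (B e d t : R) : 0 <= B -> 0 <= e -> 0 <= d -> 0 <= t ->
  (1 + e) * (B + d) + t <= (B + 1) * expR (e + d + t) - 1.
Proof.
move=> B0 e0 d0 t0.
have H1 := expR_ge1Dx e; have H2 := expR_ge1Dx (d + t).
have : (1 + e) * (1 + (d + t)) <= expR (e + d + t).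
  rewrite -addrA expRD; apply: ler_pM => //; lra.
have : 0 <= B * d by rewrite mulr_ge0.
have : 0 <= B * t by rewrite mulr_ge0.
have : 0 <= B * e by rewrite mulr_ge0.
have : 0 <= t * e by rewrite mulr_ge0.
have : 0 <= B * (e * d) by rewrite !mulr_ge0.
have : 0 <= B * (e * t) by rewrite !mulr_ge0.
nra.
Qed.

Lemma entropy_le m : entropy R k (sample_res m) m <= entropy_const * m.+1%:R.
Proof.
rewrite /entropy /sample_res /entropy_const -natrM ler_nat.
have : (3 * m + (k + 3) + m + k + 6 <= (2 * k + 15) * m.+1)%N by nia.
move: (_ + 6)%N (k.+1 ^ 2)%N => a D aD.
by apply: leq_trans (leq_add (leq_mul aD (leqnn D)) (leqnn 1)) _; nia.
Qed.


Lemma entropy_const_ge0 : 0 <= entropy_const. Proof. exact: ler0n. Qed.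
Lemma deviation_const_ge0 : 0 <= deviation_const. Proof. by rewrite /deviation_const
  !mulr_ge0// entropy_const_ge0. Qed.
Lemma refine_const_ge0 : 0 <= refine_const. Proof. exact: ler0n. Qed.

Lemma tsize_gt0 br m : (0 < tsize br m)%N.
Proof. by apply: prodn_gt0 => i; rewrite /bnum; case: ifP. Qed.

Lemma tsizeS br m : tsize br m.+1 = (tsize br m * bnum (br m))%N.
Proof. by rewrite /tsize big_ord_recr. Qed.

Section Step.
Variables (br : nat -> bool) (eps : nat -> R).
Hypothesis eps_gt0 : forall m, 0 < eps m.
Hypothesis eps_large : forall m,
  m.+1%:R * 2 ^+ m <= eps m ^+ 2 * (tsize br m)%:R :> R.

Lemma eta_ge0 i : 0 <= eta eps i.
Proof.
by rewrite /eta !addr_ge0 ?mulr_ge0 ?invr_ge0 ?exprn_ge0 ?deviation_const_ge0 ?refine_const_ge0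
  ?(ltW (eps_gt0 i)).
Qed.

Lemma charge_bound_ge1 m : 1 <= charge_bound eps m.
Proof.
rewrite /charge_bound -[leLHS]mulr1 ler_pM ?ler1n//.
rewrite (le_trans _ (expR_ge1Dx _))// lerDl.
by apply: sumr_ge0 => i _; exact: eta_ge0.
Qed.

(* Dividing a charge by N 2^r / 4^m makes its conditional expectation constant
   along the construction. *)
Lemma charge_bound_step m (S S' : R) (b := (bnum (br m))%:R : R) (N := (tsize br m)%:R : R)
    (r := sample_res m) :
  S <= (charge_bound eps m - 1) * N * 2 ^+ r / 4 ^+ m ->
  4 * S' <= b * ((1 + eps m) * (S + entropy R k r m * (2 * k.+1%:R * 2 ^+ (r - m)) / eps m)) ->
  8 * S' + refine_const * (N * b) <= (charge_bound eps m.+1 - 1) * (N * b) * 2 ^+ sample_res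
    m.+1 / 4 ^+ m.+1.
Proof.
move=> HS HS'.
have e0 := eps_gt0 m; set e := eps m in HS' e0 *.
have N0 : 0 < N by rewrite ltr0n tsize_gt0.
have b0 : 0 < b by rewrite ltr0n /bnum; case: ifP.
set B := charge_bound eps m - 1 in HS.
have B0 : 0 <= B by rewrite subr_ge0 charge_bound_ge1.
have p2 n : 0 < 2 ^+ n :> R by rewrite exprn_gt0.
have p4 : 0 < 4 ^+ m :> R by rewrite exprn_gt0.
have E4 : 4 ^+ m = 2 ^+ m * 2 ^+ m :> R by rewrite -exprMn; congr (_ ^+ _); ring.
have Er : 2 ^+ r = 2 ^+ m * 2 ^+ (r - m) :> R by rewrite -exprD; congr (_ ^+ _);
  rewrite /r /sample_res; lia.
have Er' : 2 ^+ sample_res m.+1 = 8 * 2 ^+ r :> R.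
  by rewrite (_ : sample_res m.+1 = 3 + r)%N ?exprD; [congr (_ * _); ring|rewrite /r /sample_res;
    lia].
pose U : R := N * 2 ^+ r / 4 ^+ m.
have U0 : 0 < U by rewrite divr_gt0// mulr_gt0.
(* The entropy is at most linear in m + 1, so [eps_large] bounds the deviation term by a multiple of
   eps times the unit [U]. *)
have He : entropy R k r m * (2 * k.+1%:R * 2 ^+ (r - m)) / e <= deviation_const * e * U.
  rewrite ler_pdivrMr//.
  have -> : deviation_const * e * U * e = (e ^+ 2 * N) * (deviation_const * 2 ^+ (r - m) / 2 ^+ m).
    by rewrite /U E4 Er; field; rewrite gt_eqF.
  apply: le_trans (_ : m.+1%:R * 2 ^+ m * (deviation_const * 2 ^+ (r - m) / 2 ^+ m) <= _);
    last first.
    by rewrite ler_wpM2r// divr_ge0 ?mulr_ge0 ?deviation_const_ge0 ?(ltW (p2 _)).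
  have -> : m.+1%:R * 2 ^+ m * (deviation_const * 2 ^+ (r - m) / 2 ^+ m) =
            entropy_const * m.+1%:R * (2 * k.+1%:R * 2 ^+ (r - m)).
    by rewrite /deviation_const; field; rewrite gt_eqF.
  by rewrite ler_wpM2r ?entropy_le// !mulr_ge0// ltW.
have H1 : 4 * S' <= b * U * ((1 + e) * (B + deviation_const * e)).
  apply: le_trans HS' _; rewrite -(mulrA b U) ler_wpM2l ?(ltW b0)//.
  rewrite [leRHS]mulrCA ler_wpM2l ?addr_ge0 ?(ltW e0)//.
  rewrite mulrDr; apply: lerD; last by rewrite [leRHS]mulrC.
  by rewrite (_ : U * B = B * N * 2 ^+ r / 4 ^+ m)//; rewrite /U; ring.
have H2 : refine_const * (N * b) <= b * U * (2 * (refine_const / 2 ^+ m)).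
  rewrite (_ : b * U * _ = (N * b) * (refine_const * (2 * 2 ^+ (r - m) / 4 ^+ m))); last first.
    by rewrite /U E4 Er; field; rewrite gt_eqF.
  rewrite [leLHS]mulrC; apply: ler_wpM2l; first by apply: mulr_ge0; exact: ltW.
  rewrite ler_peMr ?refine_const_ge0// ler_pdivlMr// mul1r E4 -exprD -exprS.
  by rewrite ler_weXn2l ?ler1n// /r /sample_res; lia.
have H3 : (1 + e) * (B + deviation_const * e) + refine_const / 2 ^+ m <= charge_bound eps m.+1 - 1.
  have d0 : 0 <= deviation_const * e by apply: mulr_ge0; [exact: deviation_const_ge0|exact: ltW].
  have t0 : 0 <= refine_const / 2 ^+ m by apply: divr_ge0; [exact: refine_const_ge0|exact: ltW].
  apply: le_trans (growth_step B0 (ltW e0) d0 t0) _.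
  by rewrite /B subrK /charge_bound big_ord_recr /= -mulrA -expRD.
have -> : (charge_bound eps m.+1 - 1) * (N * b) * 2 ^+ sample_res m.+1 / 4 ^+ m.+1 =
          b * U * (2 * (charge_bound eps m.+1 - 1)).
  by rewrite Er' exprS /U; field; rewrite gt_eqF.
apply: le_trans (_ : b * U * (2 * ((1 + e) * (B + deviation_const * e) + refine_const / 2 ^+
  m)) <= _).
  rewrite mulrDr mulrDr; apply: lerD => //.
  rewrite (_ : 8 * S' = 2 * (4 * S')); last by ring.
  by rewrite [leRHS]mulrCA ler_wpM2l.
by apply: ler_wpM2l; [apply: mulr_ge0; exact: ltW|exact: ler_wpM2l].
Qed.

Lemma balanced_step m s : balanced br eps m s ->
  exists2 s', balanced br eps m.+1 s' &
    (forall q, q \in s' -> parent q \in s) /\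
    (forall q, q \in s -> count (fun p => parent p == q) s' = bnum (br m)).
Proof.
move=> [us sr ss HS].
have mr : (m < sample_res m)%N by rewrite /sample_res; lia.
have [ch [uch sch Hch]] := @refinement_exists (br m) (sample_res m) m s (eps m) us sr mr
  (eps_gt0 m).
exists (subcells ch s); last first.
  by split=> [q|q qs]; [exact: subcells_parent|exact: subcells_count].
split; first exact: subcells_uniq.
- exact: subcells_in_range.
- by rewrite (size_subcells _ sch) ss tsizeS.
move=> o c; rewrite tsizeS natrM; apply: le_trans (charge_bound_step (HS o c) (Hch o c)).
have -> : (tsize br m)%:R * (bnum (br m))%:R = (size (subcells ch s))%:R :> R.
  by rewrite (size_subcells _ sch) ss natrM.
rewrite /refine_const -!natrM -natrD ler_nat.
have -> : sample_res m.+1 = (sample_res m + 3)%N by rewrite /sample_res; lia.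
rewrite big_distrr/= -sum1_size big_distrr/= -big_split/=.
apply: leq_sum => q _; rewrite muln1 /ocnt.
by case: o; apply: cnt_refine; rewrite /sample_res; lia.
Qed.

End Step.

(** Bounded partial sums of [eps] keep [charge_bound] below one constant at all levels, and
    [near_count] turns bounded charges into few near cells. *)
Theorem tree_avoiding_curves (br : nat -> bool) (eps : nat -> R) (S : R) :
  (forall m, 0 < eps m) ->
  (forall m, m.+1%:R * 2 ^+ m <= eps m ^+ 2 * (tsize br m)%:R) ->
  (forall n, \sum_(i < n) eps i <= S) ->
  exists (A : nat -> seq (nat * nat)) (K : R),
    [/\ A 0%N = [:: (0%N, 0%N)],
        forall m, uniq (A m) /\ size (A m) = tsize br m,
        forall m q, q \in A m.+1 -> parent q \in A m,
        forall m q, q \in A m -> count (fun p => parent p == q) (A m.+1) = bnum (br m) &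
        forall m c, c != 0 ->
          (count (fun q => `[< near_cell m c q >]) (A m))%:R <= K * (tsize br m)%:R / 2 ^+ m].
Proof.
move=> e0 el eS.
have bal0 : balanced br eps 0 [:: (0%N, 0%N)].
  split=> [//|//||o c]; first by rewrite /tsize big_ord0.
  rewrite /tsize big_ord0 big_seq1 /charge_bound big_ord0 expR0 mulr1 expr0 invr1 !mulr1.
  rewrite -natr1 addrK; apply: le_trans (_ : (2 ^ (sample_res 0 - 0) * k)%:R <= _).
    by rewrite ler_nat ocnt_le.
  by rewrite subn0 natrM natrX mulrC.
have [A [A0 balA QA]] := dependent_choice_nat bal0 (fun m s => @balanced_step br eps e0 el m s).
pose Bd : R := k.+1%:R * expR (S + deviation_const * S + refine_const * 2).
have bB m : charge_bound eps m - 1 <= Bd.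
  apply: le_trans (_ : charge_bound eps m <= _); first by rewrite gerBl.
  rewrite ler_wpM2l// ler_expR !big_split/= -!mulr_sumr.
  apply: lerD; first by apply: lerD; [exact: eS|apply: ler_wpM2l;
    [exact: deviation_const_ge0|exact: eS]].
  apply: ler_wpM2l; first exact: refine_const_ge0.
  suff -> : \sum_(i < m) (2 ^+ i)^-1 = 2 - 2 / 2 ^+ m :> R.
    by rewrite gerBl divr_ge0// exprn_ge0.
  elim: m => [|m IH]; first by rewrite big_ord0 expr0 divr1 subrr.
  by rewrite big_ord_recr/= IH exprS; field; rewrite gt_eqF// exprn_gt0.
exists A, ((25 * 25 * k.+2)%:R * Bd * 8); split=> //.
- by move=> m; have [] := balA m.
- by move=> m; have [] := QA m.
- by move=> m; have [] := QA m.
move=> m c c0; have [_ _ _ HS] := balA m.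
pose Y : R := Bd * (tsize br m)%:R * 2 ^+ sample_res m / 4 ^+ m.
have Bd0 : 0 <= Bd by rewrite mulr_ge0// expR_ge0.
have Y0 : 0 <= Y.
  apply: divr_ge0; last exact: exprn_ge0.
  by apply: mulr_ge0; [exact: mulr_ge0|exact: exprn_ge0].
have HY o c' : (\sum_(q <- A m) ocnt o (sample_res m) m c' q <= Num.truncn Y)%N.
  rewrite truncn_ge_nat//; apply: le_trans (HS o c') _.
  by do 3 (apply: ler_wpM2r; first by rewrite ?invr_ge0 ?exprn_ge0); exact: bB.
have kg : (k <= 2 ^ (sample_res m - m - 3))%N.
  apply: (@leq_trans (2 ^ k)); first by rewrite ltnW// ltn_expl.
  by rewrite leq_pexp2l// /sample_res; lia.
have := near_count c0 _ kg HY.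
rewrite (_ : m + 3 <= sample_res m)%N; last by rewrite /sample_res; lia.
move=> /(_ isT); rewrite -(ler_nat R) => H.
have g0 : 0 < (2 ^ (sample_res m - m - 3))%:R :> R by rewrite natrX exprn_gt0.
rewrite -(ler_pM2l g0) -natrM; apply: le_trans H _.
rewrite mulnA natrM; apply: le_trans (_ : (25 * 25 * k.+2)%:R * Y <= _).
  by rewrite ler_wpM2l// truncn_le.
rewrite le_eqVlt; apply/orP; left; apply/eqP; rewrite /Y.
have -> : 2 ^+ sample_res m = 8 * 2 ^+ m * (2 ^ (sample_res m - m - 3))%:R :> R.
  rewrite natrX (_ : 8 = 2 ^+ 3); last by ring.
  by rewrite -!exprD; congr (_ ^+ _); rewrite /sample_res; lia.
have -> : 4 ^+ m = 2 ^+ m * 2 ^+ m :> R by rewrite -exprMn; congr (_ ^+ _); ring.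
by field; rewrite gt_eqF// exprn_gt0.
Qed.

End TreeConstruction.

(** * The integral condition on dyadic scales *)

Section DyadicSum.
Variables (R : realType) (h : R -> R).
Hypothesis h_gt0 : forall t : R, 0 < t -> 0 < h t.
Hypothesis h_mono : forall s t : R, 0 < s -> s <= t -> h s <= h t.
Hypothesis h_cont : forall t : R, 0 < t -> {for t, continuous h}.
Hypothesis h_dbl : forall t : R, 0 < t -> h (2 * t) <= 2 ^+ 2 * h t.

Let F (t : R) : R := t^-1 * `|ln t| * Num.sqrt (t^-1 * h t).

Let F_ge0 t : 0 < t -> 0 <= F t.
Proof. by move=> t0; rewrite !mulr_ge0 ?invr_ge0 ?sqrtr_ge0// ltW. Qed.

Let F_measurable : measurable_fun (`]0, 1]%classic : set R) (EFin \o F).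
Proof.
apply/measurable_EFinP.
apply: (@measurable_funS _ _ _ _ (`]0, +oo[%classic : set R)) => //.
  by apply: subset_itvl; rewrite bnd_simp.
apply: open_continuous_measurable_fun; first exact: interval_open.
move=> t; rewrite inE/= in_itv/= andbT => t0.
have ct : {for t, continuous (fun x : R => x^-1)}.
  by apply: inv_continuous; rewrite gt_eqF.
apply: cvgM; first apply: cvgM => //.
  by apply: cvg_norm; exact: continuous_ln.
apply: continuous_cvg; first exact: sqrt_continuous.
by apply: cvgM => //; exact: h_cont.
Qed.

(** On this interval 1/t >= 2^n and |ln t| >= n ln 2, while monotonicity and doubling give h(t) >=
    h(2^-n) / 4; the length is 2^-n / 2. *)
Lemma dyadic_piece n :
  ((ln 2 / 4 * (n%:R * Num.sqrt (2 ^+ n * h (2 ^- n))))%:E <=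
   \int[lebesgue_measure]_(t in `](2 ^- n / 2)%R, (2 ^- n)%R]) (F t)%:E)%E.
Proof.
set b : R := 2 ^- n; set a := b / 2.
have b0 : 0 < b by rewrite invr_gt0 exprn_gt0.
have a0 : 0 < a by rewrite mulr_gt0// invr_gt0.
have ab : a < b by rewrite /a gtr_pMr// invf_lt1// ltr1n.
have b1 : b <= 1 by rewrite invf_le1 ?exprn_gt0// exprn_ege1// ler1n.
have m2 : 0 < ln 2 :> R by rewrite ln_gt0// ltr1n.
set C := Num.sqrt (2 ^+ n * h b).
pose c : R := 2 ^+ n * (n%:R * ln 2) * (C / 2).
have c0 : 0 <= c by rewrite !mulr_ge0 ?exprn_ge0 ?sqrtr_ge0// ltW.
apply: (@le_trans _ _ (\int[lebesgue_measure]_(t in `]a, b]) (cst c%:E t))%E).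
  rewrite integral_cst//= lebesgue_measure_itv/= lte_fin ab -EFinD -EFinM lee_fin.
  rewrite le_eqVlt; apply/orP; left; apply/eqP; rewrite /c /a /b /C.
  by field; rewrite gt_eqF// exprn_gt0.
apply: ge0_le_integral => //=.
- apply: measurable_funS F_measurable => //.
  by apply: subset_itv; rewrite bnd_simp// ltW.
- move=> t; rewrite in_itv/= => /andP[at_ tb]; rewrite lee_fin.
  have t0 : 0 < t := lt_trans a0 at_.
  have tinv : 2 ^+ n <= t^-1 by rewrite -[leLHS]invrK lef_pV2 ?posrE.
  rewrite /F /c; apply: ler_pM; rewrite ?mulr_ge0 ?exprn_ge0 ?invr_ge0 ?sqrtr_ge0 ?(ltW m2)//.
    apply: ler_pM; rewrite ?mulr_ge0 ?exprn_ge0 ?(ltW m2)//.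
    have -> : n%:R * ln 2 = - ln b :> R.
      by rewrite /b lnV ?posrE ?exprn_gt0// opprK lnXn// mulr_natl.
    rewrite ler_normr; apply/orP; right.
    by rewrite lerN2 ler_ln ?posrE.
  have -> : C / 2 = Num.sqrt (2 ^+ n * (h b / 4)).
    rewrite mulrA sqrtrM ?mulr_ge0 ?exprn_ge0 ?ltW ?h_gt0//; congr (_ * _).
    by rewrite sqrtrV// (_ : 4 = 2 ^+ 2) ?sqrtr_sqr ?ger0_norm//; ring.
  rewrite ler_wsqrtr// ler_pM ?exprn_ge0 ?divr_ge0 ?(ltW (h_gt0 _))//.
  rewrite ler_pdivrMr// mulrC.
  apply: le_trans (_ : 4 * h a <= _); last by rewrite ler_wpM2l// h_mono// ltW.
  have := h_dbl a0; rewrite /a mulrCA divff// mulr1 -/b.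
  by rewrite (_ : 2 ^+ 2 = 4)//; ring.
Qed.

Lemma dyadic_sum_bounded :
  (\int[lebesgue_measure]_(t in `]0%R, 1%R]) (F t)%:E < +oo)%E ->
  exists S, forall n, \sum_(i < n) i%:R * Num.sqrt (2 ^+ i * h (2 ^- i)) <= S.
Proof.
move=> fin; set I := (\int[_]_(t in _) _)%E in fin.
have m2 : 0 < ln 2 :> R by rewrite ln_gt0// ltr1n.
have pw i : 0 < 2 ^- i :> R by rewrite invr_gt0 exprn_gt0.
have partial n : ((ln 2 / 4 * \sum_(i < n) i%:R * Num.sqrt (2 ^+ i * h (2 ^- i)))%:E <=
    \int[lebesgue_measure]_(t in `](2 ^- n)%R, 1%R]) (F t)%:E)%E.
  elim: n => [|n IH].
    rewrite big_ord0 mulr0; apply: integral_ge0 => t /=.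
    rewrite in_itv/= => /andP[t1 _]; rewrite lee_fin.
    exact: F_ge0 (lt_trans (pw 0%N) t1).
  have b0 : 0 < 2 ^- n :> R by rewrite invr_gt0 exprn_gt0.
  have ab : 2 ^- n.+1 <= 2 ^- n :> R.
    by rewrite lef_pV2 ?posrE ?exprn_gt0// ler_weXn2l// ler1n.
  have b1 : 2 ^- n <= 1 :> R by rewrite invf_le1 ?exprn_gt0// exprn_ege1// ler1n.
  have e : (`]2 ^- n.+1, 1]%classic : set R) =
      `]2 ^- n.+1, 2 ^- n]%classic `|` `]2 ^- n, 1]%classic.
    by rewrite -itv_bndbnd_setU// bnd_simp.
  rewrite e ge0_integral_setU//; first last.
  - apply/disj_set2P; rewrite -subset0 => t [] /=; rewrite !in_itv/=.
    by move=> /andP[_ H1] /andP[H2 _]; move: (le_lt_trans H1 H2); rewrite ltxx.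
  - move=> t; rewrite -e /= in_itv/= => /andP[t1 _]; rewrite lee_fin.
    exact: F_ge0 (lt_trans (pw n.+1) t1).
  - rewrite -e; apply: measurable_funS F_measurable => //.
    by apply: subset_itvr; rewrite bnd_simp invr_ge0 exprn_ge0.
  rewrite big_ord_recr/= mulrDr EFinD addeC leeD//.
  have := dyadic_piece n; rewrite (_ : 2 ^- n * 2^-1 = 2 ^- n.+1)//.
  by rewrite exprSr invfM mulrC.
exists (4 / ln 2 * fine I) => n.
have I0 : (0 <= I)%E.
  apply: integral_ge0 => t /=; rewrite in_itv/= => /andP[t1 _].
  by rewrite lee_fin F_ge0.
have : ((ln 2 / 4 * \sum_(i < n) i%:R * Num.sqrt (2 ^+ i * h (2 ^- i)))%:E <= I)%E.
  apply: le_trans (partial n) _; apply: ge0_subset_integral => //.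
  - move=> t /=; rewrite in_itv/= => /andP[t1 _].
    by rewrite lee_fin F_ge0.
  - by apply: subset_itvr; rewrite bnd_simp invr_ge0 exprn_ge0.
rewrite -(@fineK _ I) ?ge0_fin_numE// lee_fin => H.
rewrite -(ler_pM2l (_ : 0 < ln 2 / 4)) ?divr_gt0//.
apply: le_trans H _; rewrite le_eqVlt; apply/orP; left; apply/eqP.
by field; rewrite gt_eqF.
Qed.
End DyadicSum.

(** * Algebraic curves as matrices *)

(** Cells are indexed in the unit square but the set lies in a square of side [s]; rescaling
    multiplies each coefficient by a power of [s], so the matrix stays nonzero. *)
Lemma mpoly_matrix (R : realType) k (p : mpoly 2 R) (s : R) :
  (1 < msize p <= k.+1)%N -> s != 0 ->
  exists2 c : 'M[R]_k.+1, c != 0 &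
    forall z : 'rV[R]_2, (cpoly c (z 0 0 / s)).[z 0 1 / s] = meval (z 0) p.
Proof.
move=> /andP[p1 pk] s0.
have mle m : m \in msupp p -> (m 0%R < k.+1)%N /\ (m 1%R < k.+1)%N.
  move=> /msize_mdeg_lt mp; have : (mdeg m < k.+1)%N := leq_trans mp pk.
  rewrite mdegE big_ord_recl big_ord1 => H.
  have -> : (1 : 'I_2) = lift ord0 ord0 by apply: val_inj.
  by split; apply: leq_ltn_trans H; [exact: leq_addr|exact: leq_addl].
pose c : 'M[R]_k.+1 := \matrix_(i, j)
  \sum_(m <- msupp p | ((m 0%R == i :> nat) && (m 1%R == j :> nat))) mcoeff m p * s ^+ (i + j).
exists c.
  have p0 : p != 0 by apply: contraTneq p1 => ->; rewrite msize0.
  have [m mp] : exists m, m \in msupp p.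
    case E : (msupp p) => [|m l]; last by exists m; rewrite mem_head.
    by move: p0; rewrite -msupp_eq0 E.
  have [m0 m1] := mle m mp.
  apply/eqP => /matrixP/(_ (Ordinal m0) (Ordinal m1)); rewrite !mxE.
  have key (m' : multinom 2) : ((m' 0%R == m 0%R :> nat) && (m' 1%R == m 1%R :> nat)) = (m' == m).
    apply/andP/eqP => [[/eqP e0 /eqP e1]|->//].
    apply/(mnmP m' m) => -[[|[|//]] Hi].
      by have -> : Ordinal Hi = 0%R by apply: val_inj.
    by have -> : Ordinal Hi = 1%R by apply: val_inj.
  rewrite (eq_bigl (pred1 m)) /=; last by move=> m'; exact: key.
  rewrite -big_filter filter_pred1_uniq ?msupp_uniq// big_seq1 => /eqP.
  by rewrite mulf_eq0 expf_eq0 (negPf s0) andbF orbF mcoeff_eq0 mp.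
move=> z; rewrite horner_cpoly mevalE.
transitivity (\sum_(i < k.+1) \sum_(j < k.+1) \sum_(m <- msupp p)
   if (m 0%R == i :> nat) && (m 1%R == j :> nat) then
     mcoeff m p * (z 0 0 ^+ m 0%R * z 0 1 ^+ m 1%R) else 0).
  apply: eq_bigr => i _; apply: eq_bigr => j _.
  rewrite mxE -big_mkcond !mulr_suml; apply: eq_bigr => m /andP[/eqP -> /eqP ->].
  by rewrite exprD !expr_div_n; field; rewrite !expf_neq0.
under eq_bigr do rewrite exchange_big.
rewrite exchange_big; apply: eq_big_seq => m /mle[m0 m1].
rewrite (bigD1 (Ordinal m0))//= (bigD1 (Ordinal m1))//= !eqxx /=.
rewrite [X in _ + X + _]big1 ?addr0 => [|j jm]; last first.
  by case: eqP => // e; move: jm; rewrite -val_eqE /= -e eqxx.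
rewrite big1 ?addr0 => [|i im]; last first.
  apply: big1 => j _; case: eqP => // e.
  by move: im; rewrite -val_eqE /= -e eqxx.
congr (_ * _); rewrite big_ord_recl big_ord1.
by have -> : (1 : 'I_2) = lift ord0 ord0 by apply: val_inj.
Qed.

(** * Hausdorff measures *)

Section Hausdorff.
Variable R : realType.
Implicit Types (x y : 'rV[R]_2) (E B : set 'rV[R]_2) (h : R -> R).

Lemma edistE x y : edist x y = Num.sqrt ((x 0 0 - y 0 0) ^+ 2 + (x 0 1 - y 0 1) ^+ 2).
Proof.
rewrite /edist big_ord_recl big_ord1.
by have -> : lift ord0 ord0 = 1 :> 'I_2 by apply: val_inj.
Qed.

Lemma edist_le x y r : 0 <= r ->
  (x 0 0 - y 0 0) ^+ 2 + (x 0 1 - y 0 1) ^+ 2 <= r ^+ 2 -> edist x y <= r.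
Proof. by move=> r0 H; rewrite edistE -(ger0_norm r0) -sqrtr_sqr ler_sqrt ?sqr_ge0. Qed.

Lemma coord_le_edist x y : `|x 0 0 - y 0 0| <= edist x y /\ `|x 0 1 - y 0 1| <= edist x y.
Proof.
rewrite edistE -!sqrtr_sqr !ler_sqrt ?addr_ge0 ?sqr_ge0//.
by rewrite lerDl lerDr !sqr_ge0.
Qed.

Lemma diam_ge0 E : (0 <= diam E)%E.
Proof. by apply: ereal_sup_ubound; left. Qed.

Lemma edist_le_diam E x y : E x -> E y -> ((edist x y)%:E <= diam E)%E.
Proof. by move=> Ex Ey; apply: ereal_sup_ubound; right; exists (x, y). Qed.

Lemma diam_le E r : 0 <= r -> (forall x y, E x -> E y -> edist x y <= r) ->
  (diam E <= r%:E)%E.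
Proof.
move=> r0 H; apply: ge_ereal_sup => _ [->|[[x y] [/= Ex Ey] <-]]; first by rewrite lee_fin.
by rewrite lee_fin H.
Qed.

Lemma diam0 : diam (@set0 'rV[R]_2) = 0%E.
Proof. by apply/eqP; rewrite eq_le diam_ge0 diam_le. Qed.

Variable h : R -> R.
Hypothesis h_gt0 : forall t : R, 0 < t -> 0 < h t.
Hypothesis h_mono : forall s t : R, 0 < s -> s <= t -> h s <= h t.

Lemma gauge_diam_ge0 E : 0 <= gauge_diam h E.
Proof. by rewrite /gauge_diam /=; case: ifP => // /h_gt0/ltW. Qed.

Lemma gauge_diam0 : gauge_diam h set0 = 0.
Proof. by rewrite /gauge_diam diam0 /= ltxx. Qed.

Lemma gauge_diam_le E r : 0 < r -> (diam E <= r%:E)%E -> gauge_diam h E <= h r.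
Proof.
move=> r0 Er; rewrite /gauge_diam /=; case: ifP => [d0|_]; last exact/ltW/h_gt0.
apply: h_mono => //.
have fE : diam E \is a fin_num by rewrite ge0_fin_numE ?diam_ge0// (le_lt_trans Er) ?ltry.
by rewrite -lee_fin fineK.
Qed.

(** A bijection of [nat] with [nat * nat] enumerates the double family; indices outside it receive
    the empty set, of gauge and diameter 0. *)
Lemma premeasure_le_esum (delta : R) B (J : set nat) (N : nat -> nat)
    (E : nat -> nat -> set 'rV[R]_2) (a : nat -> R) : 0 < delta ->
  (forall x, B x -> exists2 j, J j & exists2 i, (i < N j)%N & E j i x) ->
  (forall j i, J j -> (i < N j)%N -> (diam (E j i) < delta%:E)%E) ->
  (forall j, J j -> \sum_(i < N j) gauge_diam h (E j i) <= a j) ->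
  (hausdorff_premeasure h delta B <= \esum_(j in J) (a j)%:E)%E.
Proof.
move=> d0 cov dE aE.
pose E' (p : nat * nat) := if (p.1 \in J) && (p.2 < N p.1)%N then E p.1 p.2 else set0.
have /card_esym/ppcard_eqP[f] := card_nat2.
have g0 p : (0 <= (gauge_diam h (E' p))%:E)%E by rewrite lee_fin gauge_diam_ge0.
apply: (@le_trans _ _ (\esum_(p in [set: nat * nat]) (gauge_diam h (E' p))%:E)%E).
  apply: ereal_inf_lbound; exists (E' \o f).
    split=> [x /cov[j Jj [i iN Ex]]|n].
      exists (f^-1%FUN (j, i)) => //=; rewrite invK ?inE// /E' /= iN andbT.
      by rewrite mem_set.
    rewrite /= /E'; case: ifP => [/andP[/set_mem Jn nN]|_]; first exact: dE.
    by rewrite diam0 lte_fin.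
  rewrite nneseries_esumT; last by move=> n; exact: g0.
  symmetry.
  apply: (@reindex_esum _ _ _ [set: nat] [set: nat * nat] f (fun p => (gauge_diam h (E' p))%:E)).
  exact: bij.
have -> : [set: nat * nat] = [set: nat] `*`` (fun=> [set: nat]) by apply/seteqP; split.
rewrite -(@esum_esum _ _ _ _ _ (fun j i => (gauge_diam h (E' (j, i)))%:E))//.
rewrite [leRHS]esum_mkcond; apply: le_esum => j _.
have [/set_mem Jj|Jj] := boolP (j \in J); last first.
  by rewrite esum1// => i _; rewrite /E' /= (negPf Jj) gauge_diam0.
apply: (@le_trans _ _ (\esum_(i in `I_(N j)) (gauge_diam h (E j i))%:E)%E).
  rewrite [leRHS]esum_mkcond; apply: le_esum => i _.
  rewrite /E' /= mem_set//=; case: (ltnP i (N j)) => iN.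
    by rewrite mem_set.
  by rewrite memNset ?gauge_diam0//= ltnNge iN.
rewrite esum_fset//; last by move=> i _; rewrite lee_fin gauge_diam_ge0.
rewrite -fsbig_ord sumEFin lee_fin.
exact: aE.
Qed.

Lemma premeasure_le_sum (delta : R) B (N : nat) (E : nat -> set 'rV[R]_2) (a : R) :
  0 < delta ->
  (forall x, B x -> exists2 i, (i < N)%N & E i x) ->
  (forall i, (i < N)%N -> (diam (E i) < delta%:E)%E) ->
  \sum_(i < N) gauge_diam h (E i) <= a ->
  (hausdorff_premeasure h delta B <= a%:E)%E.
Proof.
move=> d0 cov dE aE.
have := @premeasure_le_esum delta B [set 0%N] (fun=> N) (fun=> E) (fun=> a) d0.
rewrite esum_set1 ?lee_fin; last first.
  by apply: le_trans aE; apply: sumr_ge0 => i _; exact: gauge_diam_ge0.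
by apply=> // [x /cov[i iN Ex]|j i _ /dE//]; exists 0%N => //; exists i.
Qed.

Lemma premeasure_anti B (d d' : R) : d <= d' ->
  (hausdorff_premeasure h d' B <= hausdorff_premeasure h d B)%E.
Proof.
move=> dd'; apply: le_ereal_inf => _ [E [cov dE] <-]; exists E => //; split=> // i.
by apply: lt_le_trans (dE i) _; rewrite lee_fin.
Qed.

Lemma hausdorff_cvg B : hausdorff_premeasure h d B @[d --> 0^'+] -->
  hausdorff_measure h B.
Proof.
apply: (@nonincreasing_at_right_is_cvge R (fun d => hausdorff_premeasure h d B) 0).
by near=> x => d d' _ _; exact: premeasure_anti.
Unshelve. all: by end_near. Qed.

Lemma hausdorff_le B (a : \bar R) :
  (forall d : R, 0 < d -> (hausdorff_premeasure h d B <= a)%E) ->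
  (hausdorff_measure h B <= a)%E.
Proof.
move=> H; apply: lime_le; first by apply/cvg_ex; eexists; exact: hausdorff_cvg.
by near=> d; apply: H.
Unshelve. all: by end_near. Qed.

Lemma hausdorff_ge B (d : R) : 0 < d ->
  (hausdorff_premeasure h d B <= hausdorff_measure h B)%E.
Proof.
move=> d0; apply: lime_ge; first by apply/cvg_ex; eexists; exact: hausdorff_cvg.
near=> d'; apply: premeasure_anti.
by near: d'; exact: nbhs_right_le.
Unshelve. all: by end_near. Qed.

End Hausdorff.

(** * The limit set *)

Section Descendants.
Variables (br : nat -> bool) (A : nat -> seq (nat * nat)).
Hypothesis A_uniq : forall m, uniq (A m) /\ size (A m) = tsize br m.
Hypothesis A_parent : forall m q, q \in A m.+1 -> parent q \in A m.
Hypothesis A_kids : forall m q, q \in A m ->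
  count (fun p => parent p == q) (A m.+1) = bnum (br m).

Lemma A_anc m d q : q \in A (m + d) -> iter d parent q \in A m.
Proof.
elim: d q => [|d IH] q; first by rewrite addn0.
by rewrite addnS iterSr => /A_parent/IH.
Qed.

Lemma count_parent (P : pred (nat * nat)) m :
  count (fun q => P (parent q)) (A m.+1) = (bnum (br m) * count P (A m))%N.
Proof.
rewrite -!sum1_count big_mkcond [X in (_ * X)%N]big_mkcond /= big_distrr /=.
transitivity (\sum_(q <- A m.+1) \sum_(p <- A m) (parent q == p) * P p)%N.
  apply: eq_big_seq => q /A_parent qA.
  rewrite (bigD1_seq (parent q))//= ?(A_uniq m).1// eqxx mul1n.
  rewrite big1 ?addn0 => [|p /negPf pq]; first by case: (P _).
  by rewrite eq_sym pq.
rewrite exchange_big /=; apply: eq_big_seq => p pA.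
rewrite -big_distrl /= -(A_kids pA) -sum1_count.
by rewrite [in RHS]big_mkcond; case: (P p); congr muln; apply: eq_bigr => q _; case: eqP.
Qed.

(** Branching depends only on the level, so all cells of level [m] have equally many descendants at
    level [m + d]; the product form avoids division. *)
Lemma count_anc (P : pred (nat * nat)) m d :
  (count (fun q => P (iter d parent q)) (A (m + d)) * tsize br m =
   tsize br (m + d) * count P (A m))%N.
Proof.
elim: d => [|d IH]; first by rewrite addn0 mulnC.
rewrite addnS tsizeS.
under eq_count do rewrite iterSr.
by rewrite (count_parent (fun q => P (iter d parent q))) -mulnA IH; lia.
Qed.

End Descendants.

Section LimitSet.
Variables (R : realType) (s0 : R) (br : nat -> bool) (A : nat -> seq (nat * nat)).
Hypothesis s0_gt0 : 0 < s0.
Hypothesis A0 : A 0%N = [:: (0%N, 0%N)].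
Hypothesis A_uniq : forall m, uniq (A m) /\ size (A m) = tsize br m.
Hypothesis A_parent : forall m q, q \in A m.+1 -> parent q \in A m.
Hypothesis A_kids : forall m q, q \in A m ->
  count (fun p => parent p == q) (A m.+1) = bnum (br m).
Implicit Types (q : nat * nat) (x : 'rV[R]_2) (m d : nat).

Definition cell_side m : R := s0 / 2 ^+ m.

Lemma side_gt0 m : 0 < cell_side m.
Proof. by rewrite divr_gt0// exprn_gt0. Qed.

Lemma sideS m : cell_side m = 2 * cell_side m.+1.
Proof. by rewrite /cell_side exprS; field; rewrite expf_neq0. Qed.

Lemma side_le m n : (m <= n)%N -> cell_side n <= cell_side m.
Proof.
move=> mn; rewrite ler_pM2l// lef_pV2 ?posrE ?exprn_gt0//.
by rewrite ler_weXn2l// ler1n.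
Qed.

(** Cells are closed to make the limit set closed; neighbours share their edges. *)
Definition dyadic_cell m q : set 'rV[R]_2 := [set x |
  q.1%:R * cell_side m <= x 0 0 <= q.1.+1%:R * cell_side m /\
  q.2%:R * cell_side m <= x 0 1 <= q.2.+1%:R * cell_side m].

Definition tree_limit : set 'rV[R]_2 :=
  [set x | forall m, exists2 q, q \in A m & dyadic_cell m q x].

Lemma half_interval m i (x : R) : i%:R * cell_side m.+1 <= x <= i.+1%:R * cell_side m.+1 ->
  (i./2)%:R * cell_side m <= x <= (i./2).+1%:R * cell_side m.
Proof.
have s1 := side_gt0 m.+1; rewrite (sideS m) !(mulrA _ 2) => /andP[x1 x2].
have n2 (n : nat) : n%:R * 2 = (n * 2)%:R :> R by rewrite natrM.
rewrite !n2; apply/andP; split.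
  by apply: le_trans x1; rewrite ler_pM2r// ler_nat; lia.
by apply: le_trans x2 _; rewrite ler_pM2r// ler_nat; lia.
Qed.

Lemma cell_parent m q x : dyadic_cell m.+1 q x -> dyadic_cell m (parent q) x.
Proof. by move=> [/half_interval ? /half_interval ?]; split. Qed.

Lemma cell_anc m d q x : dyadic_cell (m + d) q x -> dyadic_cell m (iter d parent q) x.
Proof.
elim: d q => [|d IH] q; first by rewrite addn0.
by rewrite addnS iterSr => /cell_parent/IH.
Qed.

(** Every cell has a child, so an infinite branch starts at [q]; in each coordinate its nested
    intervals contain the supremum of their left ends. *)
Lemma cell_point m q : q \in A m -> exists2 x, tree_limit x & dyadic_cell m q x.
Proof.
move=> qA.
have ch d p : p \in A (m + d) -> exists2 p', p' \in A (m + d.+1) & parent p' == p.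
  move=> /A_kids pk; rewrite addnS.
  have /hasP[p' p'A pp'] : has (fun p' => parent p' == p) (A (m + d).+1).
    by rewrite has_count pk /bnum; case: ifP.
  by exists p'.
have q0 : q \in A (m + 0) by rewrite addn0.
have [f [f0 fA fp]] := @dependent_choice_nat _ (fun d p => p \in A (m + d))
  (fun d p p' => parent p' == p) q q0 ch.
have fanc d e : iter e parent (f (d + e)%N) = f d.
  elim: e => [|e IH]; first by rewrite addn0.
  by rewrite addnS iterSr (eqP (fp _)).
have coord (g : nat * nat -> nat) (gp : forall p, g (parent p) = (g p)./2) :
    exists x : R, forall d, (g (f d))%:R * cell_side (m + d) <= x <= (g (f d)).+1%:R *
      cell_side (m + d).
  pose lo d := (g (f d))%:R * cell_side (m + d).
  pose hi d := (g (f d)).+1%:R * cell_side (m + d).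
  have lohi d : lo d <= hi d by rewrite ler_pM2r ?side_gt0// ler_nat.
  have step d : lo d <= lo d.+1 /\ hi d.+1 <= hi d.
    have e : g (f d) = (g (f d.+1))./2 by rewrite -gp (eqP (fp d)).
    have := @half_interval (m + d) (g (f d.+1)).
    rewrite -addnS -e => H.
    have /andP[H1 _] : lo d <= lo d.+1 <= hi d by apply: H; rewrite lexx; exact: lohi.
    have /andP[_ H2] : lo d <= hi d.+1 <= hi d.
      by apply: H; rewrite lexx andbT; exact: lohi.
    by split.
  have mlo d e : lo d <= lo (d + e)%N.
    by elim: e => [|e IH]; rewrite ?addn0// addnS (le_trans IH)//; case: (step (d + e)%N).
  have mhi d e : hi (d + e)%N <= hi d.
    by elim: e => [|e IH]; rewrite ?addn0// addnS (le_trans _ IH)//; case: (step (d + e)%N).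
  have lh d e : lo d <= hi e.
    by rewrite (le_trans (mlo d e))// (le_trans (lohi _))// addnC mhi.
  exists (sup (range lo)) => d; apply/andP; split.
    apply: sup_upper_bound; last by exists d.
    split; first by exists (lo 0%N), 0%N.
    by exists (hi 0%N) => _ [e _ <-].
  apply: ge_sup; first by exists (lo 0%N), 0%N.
  by move=> _ [e _ <-]; exact: lh.
have [x Hx] := coord fst (fun=> erefl); have [y Hy] := coord snd (fun=> erefl).
pose z : 'rV[R]_2 := \row_i (if i == 0 then x else y).
have zc d : dyadic_cell (m + d) (f d) z by rewrite /dyadic_cell /= !mxE /=; split;
  [exact: Hx|exact: Hy].
exists z; last by have := zc 0%N; rewrite addn0 f0.
move=> n; have [nm|mn] := leqP m n.
  by exists (f (n - m)%N); have := fA (n - m)%N; have := zc (n - m)%N; rewrite subnKC.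
exists (iter (m - n) parent q); first by apply: (A_anc A_parent); rewrite subnKC// ltnW.
apply: cell_anc; rewrite subnKC ?(ltnW mn)//.
by have := zc 0%N; rewrite addn0 f0.
Qed.

Lemma cell_closed m q : closed (dyadic_cell m q).
Proof.
have cl (i : 'I_2) (a b : R) : closed [set x : 'rV[R]_2 | a <= x 0 i <= b].
  have -> : [set x : 'rV[R]_2 | a <= x 0 i <= b] =
      (fun x : 'rV[R]_2 => x 0 i) @^-1` `[a, b]%classic.
    by apply/seteqP; split=> x /=; rewrite in_itv.
  apply: closed_comp; last exact: itv_closed.
  by move=> x _; exact: coord_continuous.
have -> : dyadic_cell m q = [set x : 'rV[R]_2 | q.1%:R * cell_side m <= x 0 0 <= q.1.+1%:R *
  cell_side m] `&`
    [set x : 'rV[R]_2 | q.2%:R * cell_side m <= x 0 1 <= q.2.+1%:R * cell_side m] by [].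
exact: closedI.
Qed.

Lemma limit_set_closed : closed tree_limit.
Proof.
have -> : tree_limit = \bigcap_m \big[setU/set0]_(q <- A m) dyadic_cell m q.
  apply/seteqP; split=> x H m => [_|].
    by rewrite -bigcup_seq; have [q qA qx] := H m; exists q.
  by have := H m I; rewrite -bigcup_seq => -[q qA qx]; exists q.
by apply: closed_bigI => m _; apply: closed_bigsetU => q _; exact: cell_closed.
Qed.

Lemma limit_set_compact : compact tree_limit.
Proof.
have cK := @rV_compact R 2 (fun=> `[0, s0]%classic) (fun=> @segment_compact R 0 s0).
apply: subclosed_compact limit_set_closed cK _ => x /(_ 0%N)[q].
rewrite A0 inE => /eqP-> [/=]; rewrite /cell_side expr0 divr1 !mul0r !mul1r => H1 H2 i.
rewrite /= in_itv /=; case: i => -[|[|//]] Hi.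
  by rewrite (_ : Ordinal Hi = 0)//; exact: val_inj.
by rewrite (_ : Ordinal Hi = 1)//; exact: val_inj.
Qed.

End LimitSet.

(** * Measure estimates *)

Section GaugeEstimates.
Variables (R : realType) (s0 : R) (br : nat -> bool) (A : nat -> seq (nat * nat)).
Hypothesis s0_gt0 : 0 < s0.
Hypothesis A0 : A 0%N = [:: (0%N, 0%N)].
Hypothesis A_uniq : forall m, uniq (A m) /\ size (A m) = tsize br m.
Hypothesis A_parent : forall m q, q \in A m.+1 -> parent q \in A m.
Hypothesis A_kids : forall m q, q \in A m ->
  count (fun p => parent p == q) (A m.+1) = bnum (br m).
Variable h : R -> R.
Hypothesis h_gauge : gauge_function h.
Hypothesis h_dbl : forall t : R, 0 < t -> h (2 * t) <= 2 ^+ 2 * h t.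
Hypothesis tsize_le : forall m, (tsize br m)%:R * h (cell_side s0 m) <= h s0.
Hypothesis tsize_ge : forall m, h s0 <= 4 * ((tsize br m)%:R * h (cell_side s0 m)).
Implicit Types (q : nat * nat) (x : 'rV[R]_2) (m d : nat) (B : set 'rV[R]_2).

Let h_gt0 t : 0 < t -> 0 < h t. Proof. by case: h_gauge => H _ _ _; exact: H. Qed.
Let h_mono s t : 0 < s -> s <= t -> h s <= h t.
Proof. by case: h_gauge => _ H _ _; exact: H. Qed.

Local Notation side := (cell_side s0).
Local Notation cell := (dyadic_cell s0).
Local Notation limit_set := (tree_limit s0 A).

Let side_gt0 m : 0 < side m. Proof. exact: side_gt0. Qed.

Lemma small_side (e : R) : 0 < e -> exists m, h (side m) <= e /\ side m <= e.
Proof.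
move=> e0; case: h_gauge => _ _ _ /cvgrPdist_le /(_ e e0) [d /= d0 Hd].
have [m Hm] : exists m, side m < Num.min d e.
  have de0 : 0 < Num.min d e by rewrite lt_min d0.
  exists (Num.truncn (s0 / Num.min d e)).+1.
  rewrite /cell_side ltr_pdivrMr ?exprn_gt0// mulrC -ltr_pdivrMr//.
  apply: (lt_le_trans (truncnS_gt _)); rewrite -natrX ler_nat.
  exact/ltnW/ltn_expl.
move: Hm; rewrite lt_min => /andP[md me]; exists m; split; last exact: ltW.
have := Hd (side m); rewrite /= !sub0r !normrN !gtr0_norm ?h_gt0//.
by apply.
Qed.

Lemma cell_edist m q x y : cell m q x -> cell m q y -> edist x y <= 2 * side m.
Proof.
have s := side_gt0 m.
have aux (i : nat) (u v : R) : i%:R * side m <= u <= i.+1%:R * side m ->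
    i%:R * side m <= v <= i.+1%:R * side m -> (u - v) ^+ 2 <= side m ^+ 2.
  rewrite -natr1 mulrDl mul1r; move: (_ * side m) => a /andP[u1 u2] /andP[v1 v2].
  rewrite -(ler_sqrt _ (sqr_ge0 _)) !sqrtr_sqr (gtr0_norm s) ler_norml.
  by apply/andP; split; lra.
move=> [x1 x2] [y1 y2]; apply: edist_le; first by rewrite mulr_ge0// ltW.
have H1 := aux _ _ _ x1 y1; have H2 := aux _ _ _ x2 y2.
have -> : (2 * side m) ^+ 2 = 4 * side m ^+ 2 by ring.
have := sqr_ge0 (side m); move: H1 H2; move: (_ ^+ 2) (_ ^+ 2) (_ ^+ 2) => a b c; lra.
Qed.

Lemma cell_diam m q : (diam (cell m q) <= (2 * side m)%:E)%E.
Proof.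
apply: diam_le; first by rewrite mulr_ge0// ltW.
by move=> x y; exact: cell_edist.
Qed.

Lemma gauge_cell m q : gauge_diam h (cell m q) <= 4 * h (side m).
Proof.
apply: le_trans (gauge_diam_le h_gt0 h_mono _ (cell_diam m q)) _.
  by rewrite mulr_gt0.
by apply: le_trans (h_dbl _) _; rewrite // (_ : 2 ^+ 2 = 4)//; ring.
Qed.

Lemma sum_gauge_cells m (l : seq (nat * nat)) :
  \sum_(i < size l) gauge_diam h (cell m (nth (0%N, 0%N) l i)) <=
  (size l)%:R * (4 * h (side m)).
Proof.
apply: le_trans (_ : \sum_(i < size l) 4 * h (side m) <= _).
  by apply: ler_sum => i _; exact: gauge_cell.
by rewrite sumr_const card_ord -[leLHS]mulr_natl.
Qed.

Lemma cover_cells m (P : pred (nat * nat)) x : limit_set x ->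
  (forall q, q \in A m -> cell m q x -> P q) ->
  exists2 i, (i < size (seq.filter P (A m)))%N & cell m (nth (0%N, 0%N) (seq.filter P (A m)) i) x.
Proof.
move=> /(_ m)[q qA qx] H; exists (index q (seq.filter P (A m))).
  by rewrite index_mem mem_filter H.
by rewrite nth_index// mem_filter H.
Qed.

Lemma limit_set_finite : (hausdorff_measure h limit_set < +oo)%E.
Proof.
apply: (@le_lt_trans _ _ (4 * h s0)%:E); last exact: ltry.
apply: hausdorff_le => // d d0.
have d4 : 0 < d / 4 by rewrite divr_gt0.
  have [m [_ md]] := small_side d4.
apply: (@premeasure_le_sum _ _ h_gt0 d limit_set (size (seq.filter predT (A m)))
  (fun i => cell m (nth (0%N, 0%N) (seq.filter predT (A m)) i))) => //.
- by move=> x Ax; exact: cover_cells.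
- move=> i _; apply: le_lt_trans (cell_diam _ _) _; rewrite lte_fin.
  by have := side_gt0 m; lra.
apply: le_trans (sum_gauge_cells _ _) _; rewrite filter_predT (A_uniq m).2.
by rewrite mulrCA ler_wpM2l.
Qed.

(* Below the cells of level m near the curve one can pass to cells of any finer
   level at no cost, since tsize * h (side) is essentially constant. *)
Lemma tube_part (k : nat) (K : R) (S T : set 'rV[R]_2) (w d : R) : 0 <= K ->
  (forall m (c : 'M[R]_k.+1), c != 0 ->
     (count (fun q => `[< near_cell m c q >]) (A m))%:R <= K * (tsize br m)%:R / 2 ^+ m) ->
  algebraic_curves k S -> 0 < w -> T = [set x | exists2 y, S y & edist x y < w] ->
  0 < d ->
  exists N (E : nat -> set 'rV[R]_2),
    [/\ forall x, limit_set x -> T x -> exists2 i, (i < N)%N & E i x,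
        forall i, (i < N)%N -> (diam (E i) < d%:E)%E &
        \sum_(i < N) gauge_diam h (E i) <= 4 * h s0 / s0 * (1 + 2 * K) * w].
Proof.
move=> K0 HK [p pk ->] w0 -> d0.
have hs0 := h_gt0 s0_gt0.
have fine_level m0 : exists2 e, 2 * side (m0 + e) < d & True.
  have d4 : 0 < d / 4 by rewrite divr_gt0.
  have [m [_ md]] := small_side d4.
  exists m => //; have := side_le s0_gt0 (leq_addl m0 m).
  by have := side_gt0 m; lra.
have diam_cell m (l : seq (nat * nat)) i : 2 * side m < d ->
    (diam (cell m (nth (0%N, 0%N) l i)) < d%:E)%E.
  by move=> md; apply: le_lt_trans (cell_diam _ _) _; rewrite lte_fin.
(* A tube at least as wide as the whole square pays for all cells of a fine level. *)
have [sw|ws] := leP s0 w.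
  have [e ed _] := fine_level 0%N; rewrite add0n in ed.
  exists (size (seq.filter predT (A e))), (fun i => cell e (nth (0%N, 0%N) (seq.filter predT (A
    e)) i)).
  split=> [x Ax _|i _|]; [exact: cover_cells|exact: diam_cell|].
  apply: le_trans (sum_gauge_cells _ _) _; rewrite filter_predT (A_uniq e).2 mulrCA.
  have H1 := tsize_le e.
  have H2 : 1 <= w / s0 by rewrite ler_pdivlMr// mul1r.
  apply: le_trans (_ : 4 * h s0 * 1 <= _); first by rewrite mulr1 ler_wpM2l.
  rewrite (_ : 4 * h s0 / s0 * (1 + 2 * K) * w = 4 * h s0 * (w / s0 * (1 + 2 * K))); last by ring.
  rewrite ler_wpM2l ?mulr_ge0 ?(ltW hs0)//.
  by rewrite -[leLHS]mulr1 ler_pM// lerDl mulr_ge0.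
(* At this level a point of a cell within [w] of the curve makes the cell near the curve, and 2^-m
   is still comparable to w / s0. *)
have [m wm mw] : exists2 m, w < side m & side m.+1 <= w.
  have exm : exists m, side m <= w by have [m [_ ?]] := small_side w0; exists m.
  case: (ex_minnP exm) => -[|m] mw mmin.
    by move: mw; rewrite /cell_side expr0 divr1 => /(lt_le_trans ws); rewrite ltxx.
  by exists m => //; rewrite ltNge; apply/negP => /mmin; rewrite ltnn.
have [c c0 Hc] := mpoly_matrix pk (lt0r_neq0 s0_gt0).
have [e ed _] := fine_level m.
pose P q := `[< near_cell m c (iter e parent q) >].
exists (size (seq.filter P (A (m + e)))), (fun i => cell (m + e) (nth (0%N, 0%N) (seq.filter P
  (A (m + e))) i)).
split=> [x Ax [y Sy xyw]|i _|]; [|exact: diam_cell|].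
  apply: cover_cells => // q qA qx; apply/asboolP.
  have [/andP[x1 x2] /andP[x3 x4]] := @cell_anc _ s0 s0_gt0 m e q x qx.
  have [y1 y2] := coord_le_edist x y.
  have {}y1 := le_lt_trans y1 (lt_trans xyw wm).
  have {}y2 := le_lt_trans y2 (lt_trans xyw wm).
  rewrite !ltr_norml in y1 y2; case/andP: y1 => y1 y1'; case/andP: y2 => y2 y2'.
  have two0 : 0 < 2 ^+ m :> R by rewrite exprn_gt0.
  exists (y 0 0 / s0), (y 0 1 / s0); split; first by rewrite Hc; exact: Sy.
    have -> : 2 ^+ m * (y 0 0 / s0) = y 0 0 / side m.
      by rewrite /cell_side; field; rewrite !gt_eqF.
    by rewrite ltr_pdivlMr// ltr_pdivrMr// !mulrDl; apply/andP; split; rewrite -natr1 in x2 x4; nra.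
  have -> : 2 ^+ m * (y 0 1 / s0) = y 0 1 / side m.
    by rewrite /cell_side; field; rewrite !gt_eqF.
  by rewrite ltr_pdivlMr// ltr_pdivrMr// !mulrDl; apply/andP; split; rewrite -natr1 in x2 x4; nra.
apply: le_trans (sum_gauge_cells _ _) _; rewrite size_filter.
set n := count P _.
have Hn : (n * tsize br m = tsize br (m + e) * count (fun q => `[< near_cell m c q >]) (A m))%N.
  exact: (count_anc A_uniq A_parent A_kids (fun q => `[< near_cell m c q >])).
have tm : 0 < (tsize br m)%:R :> R by rewrite ltr0n tsize_gt0.
have two0 : 0 < 2 ^+ m :> R by rewrite exprn_gt0.
have Hn' : n%:R <= (tsize br (m + e))%:R * (K / 2 ^+ m) :> R.
  rewrite -(ler_pM2r tm) -natrM Hn natrM -mulrA ler_wpM2l// mulrAC.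
  exact: HK.
apply: le_trans (_ : (tsize br (m + e))%:R * (K / 2 ^+ m) * (4 * h (side (m + e))) <= _).
  by rewrite ler_wpM2r// mulr_ge0// ltW// h_gt0.
rewrite (_ : _ * _ = 4 * (K / 2 ^+ m) * ((tsize br (m + e))%:R * h (side (m + e)))); last by ring.
apply: le_trans (_ : 4 * (K / 2 ^+ m) * h s0 <= _).
  by rewrite ler_wpM2l// mulr_ge0// divr_ge0// ltW.
have Kw : K / 2 ^+ m <= 2 * K * (w / s0).
  rewrite (_ : K / 2 ^+ m = 2 * K * (side m.+1 / s0)); last first.
    by rewrite /cell_side exprS; field; rewrite !gt_eqF.
  by rewrite ler_wpM2l ?mulr_ge0// ler_pM2r ?invr_gt0.
have ws0 : 0 <= w / s0 by rewrite divr_ge0// ltW.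
rewrite (_ : 4 * h s0 / s0 * (1 + 2 * K) * w = 4 * (w / s0 + 2 * K * (w / s0)) * h s0);
  last by ring.
rewrite ler_wpM2r ?(ltW hs0)// ler_wpM2l//.
by apply: le_trans Kw _; rewrite lerDr.
Qed.

(** * Lower bound for the Hausdorff measure *)

Definition box m (e : 'rV[R]_2) : set 'rV[R]_2 :=
  [set x | `|e 0 0 - x 0 0| < side m /\ `|e 0 1 - x 0 1| < side m].

Lemma box_open m e : open (box m e).
Proof.
have op (i : 'I_2) (a r : R) : open [set x : 'rV[R]_2 | `|a - x 0 i| < r].
  have -> : [set x : 'rV[R]_2 | `|a - x 0 i| < r] = (fun x : 'rV[R]_2 => x 0 i) @^-1` ball a r.
    by [].
  apply: open_comp; last exact: ball_open.
  by move=> x _; exact: coord_continuous.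
have -> : box m e = [set x : 'rV[R]_2 | `|e 0 0 - x 0 0| < side m] `&`
    [set x : 'rV[R]_2 | `|e 0 1 - x 0 1| < side m] by [].
exact: openI.
Qed.

(** The admissible indices lie strictly between u / side - 2 and u / side + 1, an open interval of
    length 3. *)
Lemma three_indices m (u : R) : exists a, forall (i : nat) (x : R),
  i%:R * side m <= x <= i.+1%:R * side m -> `|u - x| < side m -> (a <= i < a + 3)%N.
Proof.
pose P i := u < (i%:R + 2) * side m.
have exP : exists i, P i.
  exists (Num.truncn (u / side m)).+1; rewrite /P -ltr_pdivrMr//.
  by have := truncnS_gt (u / side m); lra.
case: (ex_minnP exP) => a Pa amin; exists a => i x.
rewrite -natr1 mulrDl mul1r => /andP[x1 x2]; rewrite ltr_norml => /andP[u1 u2].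
apply/andP; split; first by apply: amin; rewrite /P mulrDl; lra.
have : i%:R * side m < (a + 3)%:R * side m by rewrite natrD mulrDl; move: Pa; rewrite /P mulrDl;
  lra.
by rewrite ltr_pM2r// ltr_nat.
Qed.

Lemma box_meets_nine_cells m e :
  (count (fun q => `[< exists2 x, cell m q x & box m e x >]) (A m) <= 9)%N.
Proof.
have [a Ha] := three_indices m (e 0 0); have [b Hb] := three_indices m (e 0 1).
rewrite -size_filter.
have -> : (9 = size [seq (i, j) | i <- iota a 3, j <- iota b 3])%N by rewrite size_allpairs
  !size_iota.
apply: uniq_leq_size; first by rewrite filter_uniq// (A_uniq m).1.
move=> -[i j]; rewrite mem_filter => /andP[/asboolP[x [/= x1 x2] [b1 b2]] _].
change (is_true ((i, j) \in [seq (i, j) | i <- iota a 3, j <- iota b 3])).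
by apply: allpairs_f; rewrite mem_iota; [exact: Ha x1 b1|exact: Hb x2 b2].
Qed.

(** The box has the smallest dyadic side exceeding the diameter, and doubling costs a factor 4. Sets
    of diameter 0 have gauge 0 but still need an open box, which [eta] pays for. *)
Lemma set_in_box (E : set 'rV[R]_2) (eta : R) : (diam E < s0%:E)%E -> 0 < eta ->
  exists me : nat * 'rV[R]_2, (E `<=` box me.1 me.2) /\
    h (side me.1) <= 4 * gauge_diam h E + eta.
Proof.
move=> dE eta0; have g0 := gauge_diam_ge0 h_gt0 E.
have [[y Ey]|E0] := pselect (E !=set0); last first.
  have [m [hm _]] := small_side eta0; exists (m, 0); split=> [x Ex|/=].
    by exfalso; apply: E0; exists x.
  by apply: le_trans hm _; rewrite lerDr mulr_ge0.
have fE : diam E \is a fin_num by rewrite ge0_fin_numE ?diam_ge0// (lt_trans dE) ?ltry.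
have Er x : E x -> edist y x <= fine (diam E).
  by move=> Ex; rewrite -lee_fin fineK//; exact: edist_le_diam.
have inbox m : fine (diam E) < side m -> E `<=` box m y.
  move=> rm x /Er xr; have [y1 y2] := coord_le_edist y x.
  by split; [apply: le_lt_trans y1 _|apply: le_lt_trans y2 _]; exact: le_lt_trans rm.
have [r0|r0] := ltP 0 (fine (diam E)); last first.
  have [m [hm _]] := small_side eta0; exists (m, y); split=> [|/=].
    by apply: inbox; exact: le_lt_trans r0 _.
  by apply: le_trans hm _; rewrite lerDr mulr_ge0.
have exm : exists m, side m <= fine (diam E).
  by have [m [_ ?]] := small_side r0; exists m.
case: (ex_minnP exm) => -[|m] mr mmin.
  move: dE; rewrite -(fineK fE) lte_fin => /(le_lt_trans mr).
  by rewrite /cell_side expr0 divr1 ltxx.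
exists (m, y); split=> [|/=]; first by apply: inbox; rewrite ltNge; apply/negP => /mmin;
  rewrite ltnn.
apply: le_trans (_ : 4 * gauge_diam h E <= _); last by rewrite lerDl ltW.
rewrite /gauge_diam /= r0 (sideS s0 m).
apply: le_trans (h_dbl _) _ => //.
rewrite (_ : 2 ^+ 2 = 4); last by ring.
by rewrite ler_wpM2l// h_mono.
Qed.

(** Mass distribution by counting: compactness leaves finitely many open boxes, and at their finest
    level [M] a box of level m contains points of descendants of at most nine cells, a proportion at
    most 9 / N_m of all cells. *)
Lemma limit_set_positive : (0 < hausdorff_measure h limit_set)%E.
Proof.
have hs0 := h_gt0 s0_gt0.
apply: lt_le_trans (hausdorff_ge h limit_set s0_gt0).
(* 288 = 2 * 36 * 4: the nine cells and the 4 of [tsize_ge] give 36, [set_in_box] gives 4, and the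
   errors, of total at most h(s0) / 72, cost half of h(s0). *)
apply: (@lt_le_trans _ _ (h s0 / 288)%:E); first by rewrite lte_fin divr_gt0.
apply: le_ereal_inf_tmp => _ [E [cov dE] <-].
pose eta i : R := h s0 / 72 / 2 ^+ i.+1.
have eta0 i : 0 < eta i by rewrite !divr_gt0// exprn_gt0.
have [g Hg] := boolp.choice (fun i => set_in_box (dE i) (eta0 i)).
have cpt : compact limit_set := limit_set_compact A0.
rewrite compact_cover in cpt.
have [||D' _ HD'] := cpt nat setT (fun i => box (g i).1 (g i).2).
- by move=> i _; exact: box_open.
- by move=> x /cov[i _ Ex]; exists i => //; exact: (Hg i).1.
pose n := (\max_(i <- D' : seq nat) i).+1.
have covn x : limit_set x -> exists2 i : 'I_n, true & box (g i).1 (g i).2 x.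
  move=> /HD'[i /= iD ix]; have iN : (i < n)%N by rewrite ltnS;
    exact: (@leq_bigmax_seq _ _ xpredT id).
  by exists (Ordinal iN).
pose M := \max_(i < n) (g i).1.
pose P (i : nat) q := `[< exists2 x, cell (g i).1 q x & box (g i).1 (g i).2 x >].
pose cn (i : 'I_n) := count (fun q => P i (iter (M - (g i).1) parent q)) (A M).
have iM (i : 'I_n) : ((g i).1 + (M - (g i).1) = M)%N by rewrite subnKC// leq_bigmax.
have total : (tsize br M <= \sum_(i < n) cn i)%N.
  rewrite -(A_uniq M).2 -sum1_size /cn.
  under [leqRHS]eq_bigr do rewrite -sum1_count big_mkcond.
  rewrite exchange_big /= big_seq [leqRHS]big_seq; apply: leq_sum => q qA.
  have [x Ax qx] := cell_point s0_gt0 A_parent A_kids qA.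
  have [i _ ix] := covn x Ax; rewrite (bigD1 i)//=.
  suff -> : P i (iter (M - (g i).1) parent q) by [].
  by apply/asboolP; exists x => //; apply: cell_anc => //; rewrite iM.
have each (i : 'I_n) : h s0 * (cn i)%:R <= 36 * (tsize br M)%:R * h (side (g i).1).
  have := count_anc A_uniq A_parent A_kids (P i) (g i).1 (M - (g i).1).
  rewrite iM -/(cn i) => H.
  have H9 : (cn i * tsize br (g i).1 <= 9 * tsize br M)%N.
    by rewrite H mulnC leq_mul2r box_meets_nine_cells orbT.
  have hg := h_gt0 (side_gt0 (g i).1).
  apply: le_trans (ler_wpM2r (ler0n _ _) (tsize_ge (g i).1)) _.
  have -> : 4 * ((tsize br (g i).1)%:R * h (side (g i).1)) * (cn i)%:R =
      4 * (cn i * tsize br (g i).1)%:R * h (side (g i).1) by rewrite (natrM _ (cn i)); ring.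
  rewrite ler_pM2r//; apply: le_trans (_ : 4 * (9 * tsize br M)%:R <= _).
    by rewrite ler_wpM2l// ler_nat.
  by rewrite natrM mulrA -natrM.
have tM : 0 < (tsize br M)%:R :> R by rewrite ltr0n tsize_gt0.
have sum36 : h s0 <= 36 * \sum_(i < n) h (side (g i).1).
  rewrite -(ler_pM2r tM); apply: le_trans (_ : \sum_(i < n) h s0 * (cn i)%:R <= _).
    by rewrite -mulr_sumr -natr_sum ler_wpM2l ?ler_nat// ltW.
  apply: le_trans (ler_sum _ (fun i _ => each i)) _.
  by rewrite -mulr_sumr mulrAC.
have etas : \sum_(i < n) eta i <= h s0 / 72.
  suff -> : \sum_(i < n) eta i = h s0 / 72 * (1 - 2 ^- n).
    rewrite ler_piMr ?divr_ge0 ?(ltW hs0)// gerBl invr_ge0 exprn_ge0//.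
  elim: (n) => [|l IH]; first by rewrite big_ord0 expr0 invr1 subrr mulr0.
  by rewrite big_ord_recr/= IH /eta exprS; field; rewrite expf_neq0.
have sumh : \sum_(i < n) h (side (g i).1) <= 4 * (\sum_(i < n) gauge_diam h (E i)) + h s0 / 72.
  apply: le_trans (_ : \sum_(i < n) (4 * gauge_diam h (E i) + eta i) <= _).
    by apply: ler_sum => i _; exact: (Hg i).2.
  by rewrite big_split /= -mulr_sumr lerD2l.
apply: (@le_trans _ _ (\sum_(i < n) (gauge_diam h (E i))%:E)%E).
  by rewrite sumEFin lee_fin; lra.
rewrite -(big_mkord xpredT (fun i => (gauge_diam h (E i))%:E)).
by apply: nneseries_lim_ge => i _ _; rewrite lee_fin gauge_diam_ge0.
Qed.

End GaugeEstimates.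

(** * Matching the number of cells to the gauge *)

Lemma esumZl (R : realType) (J : set nat) (w : nat -> R) (C : R) : 0 <= C ->
  (forall j, J j -> 0 <= w j) ->
  (\esum_(j in J) (C * w j)%:E = C%:E * \esum_(j in J) (w j)%:E)%E.
Proof.
move=> C0 w0; rewrite esum_mkcond [in RHS]esum_mkcond.
have ge0 j : (0 <= if j \in J then (w j)%:E else 0)%E.
  by case: ifP => // /set_mem /w0; rewrite lee_fin.
rewrite -(nneseries_esumT ge0) -nneseriesZl//.
rewrite -nneseries_esumT; last first.
  by move=> j; case: ifP => // /set_mem /w0; rewrite lee_fin => /(mulr_ge0 C0).
by apply: eq_eseriesr => j _; case: ifP; rewrite ?mule0// EFinM.
Qed.

(** By [tube_part] a tube of width w carries total gauge at most CT w at any scale, so tubes of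
    total width below e / CT bound every premeasure by e. *)
Lemma limit_set_not_tube_null (R : realType) (s0 : R) br A h k (K : R) :
  0 < s0 ->
  (forall m, uniq (A m) /\ size (A m) = tsize br m) ->
  (forall m q, q \in A m.+1 -> parent q \in A m) ->
  (forall m q, q \in A m -> count (fun p => parent p == q) (A m.+1) = bnum (br m)) ->
  gauge_function h -> (forall t : R, 0 < t -> h (2 * t) <= 2 ^+ 2 * h t) ->
  (forall m, (tsize br m)%:R * h (cell_side s0 m) <= h s0) ->
  0 <= K ->
  (forall m (c : 'M[R]_k.+1), c != 0 ->
     (count (fun q => `[< near_cell m c q >]) (A m))%:R <= K * (tsize br m)%:R / 2 ^+ m) ->
  forall B, B `<=` tree_limit s0 A -> (0 < hausdorff_measure h B)%E ->
    ~ tube_null (algebraic_curves k) B.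
Proof.
move=> s0_gt0 A_uniq A_parent A_kids hg hd tl K0 HK B BA hB tn.
have [h_gt0 h_mono _ _] := hg.
pose CT := 4 * h s0 / s0 * (1 + 2 * K).
have CT0 : 0 < CT.
  by rewrite /CT mulr_gt0 ?divr_gt0 ?mulr_gt0 ?h_gt0// ltr_pwDl// mulr_ge0.
move: hB; rewrite ltNge => /negP; apply; apply: hausdorff_le => // d d0.
apply/lee_addgt0Pr => e e0; rewrite add0e.
have [J [w [T [HT cov Hw]]]] := tn (e / CT) (divr_gt0 e0 CT0).
have w0 j : J j -> 0 < w j by move=> /HT[].
pose good (j : nat) (NE : nat * (nat -> set 'rV[R]_2)) := J j ->
  [/\ forall x, tree_limit s0 A x -> T j x -> exists2 i, (i < NE.1)%N & NE.2 i x,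
      forall i, (i < NE.1)%N -> (diam (NE.2 i) < d%:E)%E &
      \sum_(i < NE.1) gauge_diam h (NE.2 i) <= CT * w j].
have exf j : exists NE, good j NE.
  have [Jj|nJ] := pselect (J j); last by exists (0%N, fun=> set0).
  have [_ [S FS TS]] := HT j Jj.
  have [N [E HE]] := tube_part s0_gt0 A_uniq A_parent A_kids hg hd tl K0 HK FS (w0 j Jj) TS d0.
  by exists (N, E).
have [f Hf] := boolp.choice exf.
apply: (@le_trans _ _ (\esum_(j in J) (CT * w j)%:E)%E).
  apply: (@premeasure_le_esum _ h h_gt0 d B J (fun j => (f j).1) (fun j => (f j).2)) => //.
  - by move=> x Bx; have [j Jj Tx] := cov x Bx; exists j => //; have [H _ _] := Hf j Jj;
    apply: H => //; exact: BA.
  - by move=> j i Jj; have [_ H _] := Hf j Jj; exact: H.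
  - by move=> j Jj; have [_ _ H] := Hf j Jj; exact: H.
rewrite esumZl ?(ltW CT0)//; last by move=> j /w0/ltW.
rewrite muleC -lee_pdivlMr// -EFinM ltW//.
Qed.

Lemma cell_center (R : realType) (s0 : R) m q : 0 < s0 ->
  exists z, dyadic_cell s0 m q `<=` ecball z (cell_side s0 m).
Proof.
move=> s0_gt0; have s := side_gt0 s0_gt0 m.
exists (\row_i ((if i == 0 then q.1%:R else q.2%:R) * cell_side s0 m + cell_side s0 m / 2)).
have aux (i : nat) (u : R) : i%:R * cell_side s0 m <= u <= i.+1%:R * cell_side s0 m ->
    (i%:R * cell_side s0 m + cell_side s0 m / 2 - u) ^+ 2 <= (cell_side s0 m / 2) ^+ 2.
  rewrite -natr1 mulrDl mul1r; move: (_ * cell_side s0 m) => a /andP[u1 u2].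
  rewrite -(ler_sqrt _ (sqr_ge0 _)) !sqrtr_sqr (gtr0_norm (divr_gt0 s _))// ler_norml.
  by apply/andP; split; lra.
move=> x [x1 x2]; apply: edist_le; first exact: ltW.
rewrite !mxE /=; have := aux _ _ x1; have := aux _ _ x2.
have -> : (cell_side s0 m / 2) ^+ 2 = cell_side s0 m ^+ 2 / 4 by field.
have := sqr_ge0 (cell_side s0 m); move: (_ ^+ 2) (_ ^+ 2) (_ ^+ 2) => a b c; lra.
Qed.

Section Branching.
Variables (R : realType) (h : R -> R) (s0 : R).
Hypothesis s0_gt0 : 0 < s0.
Hypothesis h_gauge : gauge_function h.
Hypothesis h_dbl : forall t : R, 0 < t -> h (2 * t) <= 2 ^+ 2 * h t.

(** Greedy rule: keep all four children whenever the product of number and gauge then remains at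
    most h(s0). *)
Definition refine_at m N : bool := `[< 4 * N%:R * h (cell_side s0 m.+1) <= h s0 >].

Fixpoint cell_number m : nat :=
  if m is m'.+1 then (cell_number m' * bnum (refine_at m' (cell_number m')))%N else 1%N.

Definition branching m := refine_at m (cell_number m).

Lemma tsize_branching m : tsize branching m = cell_number m.
Proof. by elim: m => [|m IH]; rewrite ?tsizeS ?IH// /tsize big_ord0. Qed.

(** With four children, doubling keeps the product from decreasing; with one child, it does not
    increase, and the failed test is the lower bound. *)
Lemma cell_number_bounds m : (cell_number m)%:R * h (cell_side s0 m) <= h s0 /\
  h s0 <= 4 * ((cell_number m)%:R * h (cell_side s0 m)).
Proof.
have [h_gt0 h_mono _ _] := h_gauge.
have sg := side_gt0 s0_gt0.
elim: m => [|m [IH1 IH2]].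
  have h0 := h_gt0 s0 s0_gt0.
  by rewrite /cell_side expr0 divr1 mul1r; split=> //; lra.
have hm := h_dbl (sg m.+1); rewrite -sideS in hm.
have mono : h (cell_side s0 m.+1) <= h (cell_side s0 m) by apply: h_mono => //; exact: side_le.
rewrite /= natrM /refine_at; case: asboolP => H.
  rewrite [_ * 4]mulrC; split=> //; apply: le_trans IH2 _.
  have := ler_wpM2l (ler0n _ (cell_number m)) hm.
  by rewrite (_ : 2 ^+ 2 = 4); [lra|ring].
rewrite mulr1; split.
  by apply: le_trans IH1; rewrite ler_wpM2l.
by rewrite mulrA; apply/ltW; rewrite ltNge; apply/negP.
Qed.
End Branching.

Theorem theorem1p3 (R : realType) :
  exists2 C : R, 0 < C &
  forall (k : nat) (h : R -> R),
    gauge_function h ->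
    (forall t : R, 0 < t -> h (2 * t) <= 2 ^+ 2 * h t) ->
    (\int[lebesgue_measure]_(t in `]0%R, 1%R])
        (t^-1 * `|ln t| * Num.sqrt (t^-1 * h t))%:E < +oo)%E ->
    exists A : set 'rV[R]_2,
      [/\ compact A,
          forall n : nat,
            covered_by_balls `|Num.ceil (C / h (2 ^- n))|%N (2 ^- n) A,
          (0 < hausdorff_measure h A < +oo)%E,
          forall B : set 'rV[R]_2, B `<=` A -> borel_set B ->
            (0 < hausdorff_measure h B)%E ->
            ~ tube_null (algebraic_curves k) B
        & ~ tube_null (algebraic_curves k) A].
Proof.
(* The constant 1 works because the set is built in a square small enough that h(s0) <= 1. *)
exists 1 => // k h hg hd hint; have [h_gt0 h_mono h_cont _] := hg.
have [S HS] := dyadic_sum_bounded h_gt0 h_mono h_cont hd hint.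
have half0 : 0 < 2^-1 :> R by rewrite invr_gt0.
have [n1 [hn1 _]] := small_side half0 hg (ltr01 : 0 < 1 :> R).
pose n0 := n1.+1; pose s0 : R := 2 ^- n0.
have s0_gt0 : 0 < s0 by rewrite invr_gt0 exprn_gt0.
have hs0 : h s0 <= 1.
  by rewrite (_ : s0 = cell_side 2^-1 n1)// /s0 /cell_side /n0 exprS invfM.
have sideE m : cell_side s0 m = 2 ^- (n0 + m) by rewrite /cell_side /s0 exprD invfM.
pose br := branching h s0.
have hN m : (tsize br m)%:R * h (cell_side s0 m) <= h s0 /\
    h s0 <= 4 * ((tsize br m)%:R * h (cell_side s0 m)).
  by rewrite tsize_branching; exact: cell_number_bounds.
have tl m := (hN m).1; have tg m := (hN m).2.
have h0 := h_gt0 _ s0_gt0.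
have sg m : 0 < cell_side s0 m by exact: side_gt0.
(* By [tg], N_m is at least h(s0) / (4 h(side)), so this dominates sqrt((m + 1) 2^m / N_m) and is
   expressed through [h], ready for the integral condition. *)
pose eps m : R := Num.sqrt (4 / h s0 * (m.+1%:R * 2 ^+ m * h (cell_side s0 m))).
have p2 m : 0 < 2 ^+ m :> R by rewrite exprn_gt0.
have arg0 m : 0 < 4 / h s0 * (m.+1%:R * 2 ^+ m * h (cell_side s0 m)).
  by rewrite mulr_gt0 ?divr_gt0// !mulr_gt0 ?ltr0n// h_gt0.
have eps0 m : 0 < eps m by rewrite sqrtr_gt0.
have eps_large m : m.+1%:R * 2 ^+ m <= eps m ^+ 2 * (tsize br m)%:R.
  rewrite sqr_sqrtr ?(ltW (arg0 m))//.
  have -> : 4 / h s0 * (m.+1%:R * 2 ^+ m * h (cell_side s0 m)) * (tsize br m)%:R =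
     (m.+1%:R * 2 ^+ m) * (4 * ((tsize br m)%:R * h (cell_side s0 m)) / h s0) by ring.
  apply: ler_peMr; first by apply: mulr_ge0 => //; exact: ltW.
  by rewrite ler_pdivlMr// mul1r; exact: tg.
pose D : R := Num.sqrt (4 / h s0 / 2 ^+ n0).
(* These are the terms of [dyadic_sum_bounded] shifted by [n0]; since n0 >= 1, m + 1 is at most (n0
   + m)^2. *)
have epsD m : eps m <= D * ((n0 + m)%:R * Num.sqrt (2 ^+ (n0 + m) * h (2 ^- (n0 + m)))).
  have D0 : 0 <= 4 / h s0 / 2 ^+ n0 by rewrite !divr_ge0// ltW.
  have -> : (n0 + m)%:R = Num.sqrt ((n0 + m)%:R ^+ 2) :> R by rewrite sqrtr_sqr ger0_norm.
  rewrite -sqrtrM ?sqr_ge0// /D -sqrtrM// ler_wsqrtr// sideE.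
  have -> : 4 / h s0 / 2 ^+ n0 * ((n0 + m)%:R ^+ 2 * (2 ^+ (n0 + m) * h (2 ^- (n0 + m)))) =
    4 / h s0 * ((n0 + m)%:R ^+ 2 * 2 ^+ m * h (2 ^- (n0 + m))).
    by rewrite [in X in _ * (_ * (X * _))]exprD; field; rewrite !gt_eqF.
  rewrite -sideE ler_pM2l ?divr_gt0// ler_pM2r ?h_gt0// ler_pM2r//.
  by rewrite -natrX ler_nat /n0 expnS expn1; nia.
have epsS n : \sum_(i < n) eps i <= D * S.
  apply: le_trans (_ : \sum_(i < n) D * ((n0 + i)%:R *
    Num.sqrt (2 ^+ (n0 + i) * h (2 ^- (n0 + i)))) <= _).
    by apply: ler_sum => i _; exact: epsD.
  rewrite -mulr_sumr ler_wpM2l ?sqrtr_ge0//; apply: le_trans (HS (n0 + n)%N).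
  by rewrite big_split_ord /= lerDr; apply: sumr_ge0 => i _; rewrite mulr_ge0// sqrtr_ge0.
have [A [K [A0 A_uniq A_parent A_kids HK]]] := tree_avoiding_curves k eps0 eps_large epsS.
pose K0 := Num.max K 0.
have K00 : 0 <= K0 by rewrite le_max lexx orbT.
have HK0 m (c : 'M[R]_k.+1) : c != 0 ->
    (count (fun q => `[< near_cell m c q >]) (A m))%:R <= K0 * (tsize br m)%:R / 2 ^+ m.
  move=> c0; apply: le_trans (HK m c c0) _.
  by rewrite ler_pM2r ?invr_gt0// ler_wpM2r// le_max lexx.
have pos := limit_set_positive s0_gt0 A0 A_uniq A_parent A_kids hg hd tg.
have ntn := limit_set_not_tube_null s0_gt0 A_uniq A_parent A_kids hg hd tl K00 HK0.
exists (tree_limit s0 A); split.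
- exact: limit_set_compact.
- move=> n; set N := `|_|%N.
  have hn : 0 < h (2 ^- n) by rewrite h_gt0// invr_gt0.
  have NE : 1 / h (2 ^- n) <= N%:R.
    apply: le_trans (ceil_ge _) _.
    by rewrite /N natr_absz ler_int ler_norm.
  have N0 : (0 < N)%N.
    rewrite lt0n; apply: contraTneq NE => ->; rewrite -ltNge divr_gt0//.
  (* Truncated subtraction: for n <= n0 the root square alone is covered, by one ball. *)
  pose m := (n - n0)%N.
  have mn : cell_side s0 m <= 2 ^- n.
    by rewrite sideE lef_pV2 ?posrE// ler_weXn2l ?ler1n// /m; lia.
  have tN : (tsize br m <= N)%N.
    have [nn|nn] := leqP n n0.
      by rewrite /m (eqP nn) /tsize big_ord0.
    rewrite -(ler_nat R); apply: le_trans NE.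
    rewrite ler_pdivlMr//; apply: le_trans hs0; apply: le_trans (tl m).
    by rewrite sideE /m subnKC// ltnW.
  have [z Hz] := boolp.choice (fun q => cell_center m q s0_gt0).
  (* Indices past the cells of level [m] repeat the ball of the default cell, padding the family to
     [N] balls. *)
  exists (fun i => z (nth (0%N, 0%N) (A m) i)) => x /(_ m)[q qA qx].
  have iN : (index q (A m) < N)%N.
    by apply: leq_trans tN; rewrite -(A_uniq m).2 index_mem.
  exists (Ordinal iN) => //=; rewrite nth_index//.
  by apply: le_trans mn; exact: Hz.
- by rewrite pos; exact: limit_set_finite.
- by move=> B BA _; exact: ntn.
- exact: ntn.
Qed.
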